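(* Suppose there is $L>0$ such that $\|\nabla f(u)-\nabla f(v)\|\le L\|u-v\|$ for all $u,v\in\mathbb{R}^n$, and suppose that $f$ satisfies the Polyak-Lojasiewicz condition with constant $\sigma>0$, i.e. $$\forall x\in\mathbb{R}^n,\qquad\|\nabla f(x)\|^2\ge2\sigma\,(f(x)-f^* ),$$ where $f^*$ is the optimal value of $\min_{x\in\mathbb{R}^n}f(x)$. Let $(x_k)_{k\ge0}$ be the iterates generated by the algorithm described in the context from any initial point $x_0\in\mathbb{R}^n$. Then for all $\epsilon\in(0,1)$ and all $k\ge0$, $$\mathbb{E}[f(x_k)-f^*]\le\left(1-2\sigma c\,\bar\alpha\, M_1\,p(\epsilon)\left(\frac{(1-\epsilon)d}{\mathcal{C}n}\right)^2\right)^k\bigl(f(x_0)-f^*\bigr),$$ where $\bar\alpha:=\min\left(1,\frac{2\beta(1-c)}{mM_2L}\right)$.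
   Context: Setting. $f:\mathbb{R}^n\to\mathbb{R}$ is of class $C^2$, and $f^*\in\mathbb{R}$ is the optimal value of $\min_{x\in\mathbb{R}^n}f(x)$. $\|\cdot\|$ is the Euclidean norm for vectors and the operator norm for matrices. $d,m$ are positive integers, much smaller than $n$, with $m$ even. Parameters: $\beta,c\in(0,1)$ and $0<M_1\le M_2$. Algorithm (exact subspace gradients). Input: a deterministic $x_0\in\mathbb{R}^n$, a symmetric matrix $H_0\in\mathbb{R}^{m\times m}$ with $M_1I_m\preceq H_0\preceq M_2I_m$, and an initial $n\times m$ matrix with normalized columns. For $k=0,1,2,\dots$: 1. Sample $Q_k\in\mathbb{R}^{n\times d}$ with independent $N(0,1)$ entries, independent of everything generated before. 2. Set $$P_k=\left[\frac{x_{k-\frac m2+1}}{\|x_{k-\frac m2+1}\|},\frac{Q_{k-\frac m2+1}Q_{k-\frac m2+1}^{\top}\nabla f(x_{k-\frac m2+1})}{\|Q_{k-\frac m2+1}Q_{k-\frac m2+1}^{\top}\nabla f(x_{k-\frac m2+1})\|},\dots,\frac{x_k}{\|x_k\|},\frac{Q_kQ_k^{\top}\nabla f(x_k)}{\|Q_kQ_k^{\top}\nabla f(x_k)\|}\right]\in\mathbb{R}^{n\times m},$$ where any column with zero denominator is replaced by the zero vector. At each iteration the first two columns are dropped and the two new columns are appended at the end; for early iterations, columns with negative indices are taken from the initial matrix. Put $g_k(u):=f(x_k+P_ku)$ for $u\in\mathbb{R}^m$, so $\nabla g_k(0)=P_k^\top\nabla f(x_k)$. 3. $\mathbf{d}_k:=-H_k\nabla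 g_k(0)$. 4. $\alpha_k:=\beta^i$, with $i\in\{0,1,2,\dots\}$ the smallest integer such that $f(x_k+\alpha_kP_k\mathbf{d}_k)\le g_k(0)+c\,\alpha_k\nabla g_k(0)^\top\mathbf{d}_k$. 5. $x_{k+1}:=x_k+\alpha_kP_k\mathbf{d}_k$. 6. With $s=\alpha_k\mathbf{d}_k$ and $y=\nabla g_k(\alpha_k\mathbf{d}_k)-\nabla g_k(0)$, set $\tilde H_{k+1}:=\left(I-\frac{sy^\top}{s^\top y}\right)H_k\left(I-\frac{ys^\top}{s^\top y}\right)+\frac{ss^\top}{s^\top y}$. 7. $H_{k+1}$ is obtained from $\tilde H_{k+1}$ by replacing its eigenvalues larger than $M_2$ by $M_2$ and those smaller than $M_1$ by $M_1$, so $M_1I_m\preceq H_{k+1}\preceq M_2I_m$. (If $s^\top y=0$, $H_{k+1}$ is any symmetric matrix determined by the history and satisfying these bounds.) Constants. $\mathcal{C}_0>0$ and $\mathcal{C}>0$ are constants such that, for a random $Q\in\mathbb{R}^{n\times d}$ with independent $N(0,1)$ entries: (i) for every $\epsilon\in(0,1)$ and $x\in\mathbb{R}^n$, $(1-\epsilon)\|x\|^2\le\|\frac1{\sqrt d}Q^\top x\|^2\le(1+\epsilon)\|x\|^2$ with probability at least $1-2e^{-\mathcal{C}_0\epsilon^2d}$; (ii) $\frac1d\|QQ^\top\|\le\mathcal{C}\frac nd$ with probability at least $1-2e^{-d}$. Set $p(\epsilon):=1-(2e^{-\mathcal{C}_0\epsilon^2d}+2e^{-d})$. Expectations are over all the matrices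 $Q_k$. *)

(* Defs.v *)
From HB Require Import structures.
From mathcomp Require Import all_boot all_order all_algebra.
From mathcomp Require Import all_classical all_reals all_analysis.

Set Implicit Arguments.
Unset Strict Implicit.
Unset Printing Implicit Defensive.

Import Order.TTheory GRing.Theory Num.Theory.
Import numFieldNormedType.Exports.

Local Open Scope classical_set_scope.
Local Open Scope ring_scope.

Section euclidean.
Context {R : realType}.

Definition dotv n (u v : 'cV[R]_n) : R := (u^T *m v) 0 0.

(* The library norm on 'cV[R]_n is the sup norm; it induces the same topology
   and hence the same notion of derivative as this one. *)
Definition enorm n (v : 'cV[R]_n) : R := Num.sqrt (dotv v v).

Definition opnorm p q (A : 'M[R]_(p, q)) : R :=
  sup [set enorm (A *m v) | v in [set v : 'cV[R]_q | enorm v <= 1]].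

(* As the inverse of 0 is 0, [normalized 0 = 0]. *)
Definition normalized n (v : 'cV[R]_n) : 'cV[R]_n := (enorm v)^-1 *: v.

(* Loewner order (for symmetric matrices): B - A is positive semidefinite. *)
Definition loewner n (A B : 'M[R]_n) : Prop :=
  forall v : 'cV[R]_n, 0 <= dotv v ((B - A) *m v).

Definition sym_between n (a b : R) (A : 'M[R]_n) : Prop :=
  [/\ A^T = A, loewner a%:M A & loewner A b%:M].

Definition clip (a b t : R) : R := Num.max a (Num.min b t).

(* B is obtained from the symmetric matrix A by clipping its eigenvalues to
   [a, b] in an orthogonal diagonalization; B does not depend on the choice of
   the diagonalization. *)
Definition clip_spectrum n (a b : R) (A B : 'M[R]_n) : Prop :=
  exists (U : 'M[R]_n) (l : 'rV[R]_n),
    [/\ U^T *m U = 1%:M,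
        A = U *m diag_mx l *m U^T
      & B = U *m diag_mx (map_mx (clip a b) l) *m U^T].

Definition grad n (f : 'cV[R]_n -> R) (x : 'cV[R]_n) : 'cV[R]_n :=
  \col_i 'D_(delta_mx i 0) f x.

Definition hessian n (f : 'cV[R]_n -> R) (x : 'cV[R]_n) : 'M[R]_n :=
  \matrix_(i, j) 'D_(delta_mx j 0) (fun y => grad f y i 0) x.

Definition class_C2 n (f : 'cV[R]_n -> R) : Prop :=
  [/\ forall x, differentiable f x,
      forall x, differentiable (grad f) x
    & continuous (hessian f)].

End euclidean.

Section gaussian.
Context d {T : measurableType d} {R : realType} (P : probability T R).

Definition mutually_independent (I : eqType) (X : I -> {RV P >-> R}) : Prop :=
  forall (s : seq I) (B : I -> set R), uniq s ->
    (forall i, measurable (B i)) ->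
    (P (\bigcap_(i in [set` s]) X i @^-1` B i) =
     \prod_(i <- s) P (X i @^-1` B i))%E.

Definition iid_std_normal (I : eqType) (X : I -> {RV P >-> R}) : Prop :=
  mutually_independent X /\
  forall i (B : set R), measurable B ->
    distribution P (X i) B = normal_prob 0 1 B.

Definition rmx p q (Q : 'I_p -> 'I_q -> {RV P >-> R}) (w : T) : 'M[R]_(p, q) :=
  \matrix_(i, j) Q i j w.

Definition gaussian_mx p q (Q : 'I_p -> 'I_q -> {RV P >-> R}) : Prop :=
  iid_std_normal (fun ij : 'I_p * 'I_q => Q ij.1 ij.2).

Definition gaussian_seq p q (Q : nat -> 'I_p -> 'I_q -> {RV P >-> R}) : Prop :=
  iid_std_normal (fun kij : nat * 'I_p * 'I_q => Q kij.1.1 kij.1.2 kij.2).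

(* Concentration of |d^(-1/2) Q^T x|^2 around |x|^2, with constant C0. *)
Definition JL_constant (p q : nat) (C0 : R) : Prop :=
  forall Q : 'I_p -> 'I_q -> {RV P >-> R}, gaussian_mx Q ->
  forall (eps : R) (x : 'cV[R]_p), 0 < eps < 1 ->
  let Y w := enorm ((Num.sqrt q%:R)^-1 *: ((rmx Q w)^T *m x)) ^+ 2 in
  ((1 - 2 * expR (- (C0 * eps ^+ 2 * q%:R)))%:E <=
   P [set w | ((1 - eps) * enorm x ^+ 2 <= Y w <= (1 + eps) * enorm x ^+ 2)%R])%E.

Definition opnorm_constant (p q : nat) (C : R) : Prop :=
  forall Q : 'I_p -> 'I_q -> {RV P >-> R}, gaussian_mx Q ->
  ((1 - 2 * expR (- q%:R))%:E <=
   P [set w | (q%:R^-1 * opnorm (rmx Q w *m (rmx Q w)^T)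
                 <= C * (p%:R / q%:R))%R])%E.

(* The sigma-algebra generated by the entries of Q_0, ..., Q_k. *)
Definition history p q (Q : nat -> 'I_p -> 'I_q -> {RV P >-> R}) (k : nat) :
    set (set T) :=
  <<s [set A | exists l i j, (l <= k)%N /\
         preimage_set_system setT (Q l i j) measurable A] >>.

Definition history_measurable p q (Q : nat -> 'I_p -> 'I_q -> {RV P >-> R})
    (k : nat) r s (B : T -> 'M[R]_(r, s)) : Prop :=
  forall i j, preimage_set_system setT (fun w => B w i j) measurable
                `<=` history Q k.

End gaussian.

Section algorithm.
Context {R : realType}.

(* Drops the first two columns of P and appends the columns u and v; here m is
   meant to be even and positive, so that the last two column indices are
   an even one followed by an odd one. *)
Definition push_cols n m (P : 'M[R]_(n, m)) (u v : 'cV[R]_n) : 'M[R]_(n, m) :=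
  \matrix_(i, j) if insub j.+2 is Some j' then P i j'
                 else if odd j then v i 0 else u i 0.

Definition restricted n m (f : 'cV[R]_n -> R) (x : 'cV[R]_n)
    (P : 'M[R]_(n, m)) : 'cV[R]_m -> R :=
  fun u => f (x + P *m u).

Definition armijo n m (f : 'cV[R]_n -> R) (c : R) (x : 'cV[R]_n)
    (P : 'M[R]_(n, m)) (dir : 'cV[R]_m) (a : R) : Prop :=
  let g := restricted f x P in
  f (x + a *: (P *m dir)) <= g 0 + c * a * dotv (grad g 0) dir.

Definition first_power (beta : R) (A : R -> Prop) (a : R) : Prop :=
  exists i : nat, [/\ a = beta ^+ i, A (beta ^+ i)
    & forall j : nat, (j < i)%N -> ~ A (beta ^+ j)].

Definition bfgs m (H : 'M[R]_m) (s y : 'cV[R]_m) : 'M[R]_m :=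
  (1%:M - (dotv s y)^-1 *: (s *m y^T)) *m H
    *m (1%:M - (dotv s y)^-1 *: (y *m s^T))
  + (dotv s y)^-1 *: (s *m s^T).

End algorithm.

Section run.
Context d0 {T : measurableType d0} {R : realType} (P : probability T R).
Context (n d m : nat) (f : 'cV[R]_n -> R) (beta c M1 M2 : R).
Context (x0 : 'cV[R]_n) (H0 : 'M[R]_m) (Pinit : 'M[R]_(n, m)).
Context (Q : nat -> 'I_n -> 'I_d -> {RV P >-> R}).

(* The iterates x_k, P_k, H_k, alpha_k as functions of the outcome w. *)
Record qn_run (x : nat -> T -> 'cV[R]_n) (Pk : nat -> T -> 'M[R]_(n, m))
    (H : nat -> T -> 'M[R]_m) (alpha : nat -> T -> R)
    (g := fun k w => restricted f (x k w) (Pk k w))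
    (dir := fun k w => - (H k w *m grad (g k w) 0))
    (s := fun k w => alpha k w *: dir k w)
    (y := fun k w => grad (g k w) (alpha k w *: dir k w) - grad (g k w) 0)
    : Prop := QNRun {
  run_x0 : forall w, x 0 w = x0;
  run_H0 : forall w, H 0 w = H0;
  run_P : forall k w,
    Pk k w = push_cols (if k is k'.+1 then Pk k' w else Pinit)
      (normalized (x k w))
      (normalized (rmx (Q k) w *m (rmx (Q k) w)^T *m grad f (x k w)));
  run_alpha : forall k w,
    first_power beta (armijo f c (x k w) (Pk k w) (dir k w)) (alpha k w);
  run_x : forall k w, x k.+1 w = x k w + alpha k w *: (Pk k w *m dir k w);
  run_H : forall k w, dotv (s k w) (y k w) != 0 ->
    clip_spectrum M1 M2 (bfgs (H k w) (s k w) (y k w)) (H k.+1 w);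
  (* When s^T y = 0, H_{k+1} is any admissible matrix that is a measurable
     function of Q_0, ..., Q_k. *)
  run_H_degenerate : forall k, exists2 B : T -> 'M[R]_m,
    history_measurable Q k B
    & forall w, dotv (s k w) (y k w) = 0 ->
        sym_between M1 M2 (B w) /\ H k.+1 w = B w
}.

End run.

Definition success_prob {R : realType} (C0 : R) (d : nat) (eps : R) : R :=
  1 - (2 * expR (- (C0 * eps ^+ 2 * d%:R)) + 2 * expR (- d%:R)).

Definition alpha_bar {R : realType} (m : nat) (beta c M2 L : R) : R :=
  Num.min 1 (2 * beta * (1 - c) / (m%:R * M2 * L)).

(* Main.v *)
Require Import Defs.
From HB Require Import structures.
From mathcomp Require Import all_boot all_order all_algebra.
From mathcomp Require Import all_classical all_reals all_analysis.
From mathcomp Require Import measurable_realfun ring lra.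

Set Implicit Arguments.
Unset Strict Implicit.
Unset Printing Implicit Defensive.

Import Order.TTheory GRing.Theory Num.Theory.
Import numFieldNormedType.Exports.

Local Open Scope classical_set_scope.
Local Open Scope ring_scope.

(** The proof separates what holds on every trajectory from what holds on
    average.

    Deterministic part. Let g be the gradient of f at x_k. The Armijo search
    never accepts a step smaller than alpha_bar ([alpha_bar_le]): a rejected
    step b violates the sufficient decrease test, and the descent inequality
    for L-smooth functions ([smooth_descent]), together with
    |P_k u|^2 <= m |u|^2 and |H u|^2 <= M2 <u, H u>, forces
    b > 2 (1 - c) / (m M2 L). As H_k >= M1, the accepted step decreases f by at
    least c alpha_bar M1 |P_k^T g|^2 ([armijo_decrease]). The norm |P_k^T g| is
    at least the component of g along the last column of P_k, which is
    |Q^T g|^2 / |Q Q^T g|. When Q_k is well conditioned for g, this is at least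
    (1 - eps) d / (C n) times |g| ([well_conditioned_projection]), and the
    Polyak-Lojasiewicz inequality bounds |g|^2 below by the gap f(x_k) - f*
    ([run_contraction]). So the gap never increases, and shrinks by a fixed
    proportion kappa on the good event.

    Probabilistic part. For a deterministic vector the good event has
    probability at least p(eps), by a union bound. Here the vector g is random,
    but it is a function of Q_0, ..., Q_(k-1), hence independent of Q_k.
    Conditioning on the past is replaced by Tonelli's theorem on the product of
    two copies of the sample space, one with the sigma-algebra of the past
    sketches and one with that of Q_k ([freezing]). This requires the iterates
    to be measurable with respect to the past ([run_measurable]). The only
    delicate point there is the spectral clipping of H: it is 1-Lipschitz for
    the Frobenius norm ([clip_spectrum_contraction]), from which measurability
    follows.

    Hence E_(k+1) <= (1 - kappa p(eps)) E_k for the expected gaps, and the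
    theorem follows by induction when the factor is nonnegative, while a
    negative factor forces all the expected gaps to be 0 ([geometric_decay]). *)

(** * Independent blocks of a family of random variables *)

Section independence.
Context d {T : measurableType d} {R : realType} (P : probability T R).
Context {I : eqType} (X : I -> {RV P >-> R}).

Definition events_of (s : seq I) : set (set T) :=
  [set A | exists2 i, i \in s & preimage_set_system setT (X i) measurable A].

(** A generating family of the same sigma-algebra as [events_of s], but stable
    under intersection, which is what uniqueness of measures requires. *)
Definition cylinders (s : seq I) : set (set T) :=
  [set A | exists B : I -> set R, (forall i, measurable (B i)) /\
     A = \bigcap_(i in [set` s]) X i @^-1` B i].

Lemma measurable_RV_preimage i (B : set R) :
  measurable B -> measurable (X i @^-1` B).
Proof. by move=> mB; exact: measurable_funPTI. Qed.

Lemma cylinders_setI s : setI_closed (cylinders s).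
Proof.
move=> _ _ [B [mB ->]] [C [mC ->]].
exists (fun i => B i `&` C i); split; first by move=> i; exact: measurableI.
by rewrite -bigcapI; apply: eq_bigcapr => i _; rewrite preimage_setI.
Qed.

Lemma cylinders_setT s : cylinders s setT.
Proof.
exists (fun=> setT); split => //.
by apply/esym; rewrite -subTset => w _ i _.
Qed.

Lemma cylinders_measurable s : cylinders s `<=` measurable.
Proof.
move=> _ [B [mB ->]]; apply: fin_bigcap_measurable; first exact: finite_seq.
by move=> i _; exact: measurable_RV_preimage.
Qed.

Lemma sigma_cylinders_measurable s A : <<s cylinders s >> A -> measurable A.
Proof.
move=> sA; apply: sA; split; first exact: sigma_algebra_measurable.
exact: cylinders_measurable.
Qed.

Lemma events_sub_cylinders s : events_of s `<=` cylinders s.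
Proof.
move=> A [i si [B mB <-]]; exists (fun j => if j == i then B else setT).
split; first by move=> j; case: ifP.
rewrite setTI; apply/seteqP; split => w /=.
  by move=> XB j _ /=; case: eqP => [->|].
by move=> /(_ i si); rewrite /= eqxx.
Qed.

Lemma sigma_events_sub_cylinders s : <<s events_of s >> `<=` <<s cylinders s >>.
Proof. exact: sub_smallest2r (@events_sub_cylinders s). Qed.

Hypothesis indep : mutually_independent X.
Variables s1 s2 : seq I.
Hypothesis s12 : uniq (s1 ++ s2).

Lemma indep_cylinders A B : cylinders s1 A -> cylinders s2 B ->
  P (A `&` B) = (P A * P B)%E.
Proof.
move=> [A' [mA ->]] [B' [mB ->]].
have := s12; rewrite cat_uniq => /and3P[u1 /hasPn dis u2].
pose C i := if i \in s1 then A' i else B' i.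
have mC i : measurable (C i) by rewrite /C; case: ifP.
have CA i : i \in s1 -> C i = A' i by rewrite /C => ->.
have CB i : i \in s2 -> C i = B' i.
  by move=> /dis /negbTE /= i1; rewrite /C i1.
rewrite (indep u1 mA) (indep u2 mB).
rewrite (eq_big_seq (fun i => P (X i @^-1` C i))); last first.
  by move=> i i1; rewrite CA.
rewrite [X in (_ * X)%E](eq_big_seq (fun i => P (X i @^-1` C i))); last first.
  by move=> i i2; rewrite CB.
rewrite -big_cat -(indep s12 mC) /=; congr (P _).
apply/seteqP; split => w /=.
  move=> [wA wB] i /=; rewrite mem_cat => /orP[] si /=.
    by rewrite CA//; exact: wA.
  by rewrite CB//; exact: wB.
move=> wC; split => i si /=.
  by have := wC i; rewrite /= mem_cat si CA//; exact.
by have := wC i; rewrite /= mem_cat si orbT CB//; exact.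
Qed.

(** The product rule for cylinders is the definition of mutual independence. It
    extends to the generated sigma-algebras one argument at a time, because for
    a fixed C both D |-> P (D `&` C) and D |-> P D * P C are finite measures
    that agree on a generating pi-system. *)
Lemma indep_sigma_cylinders A B :
  <<s cylinders s1 >> A -> <<s cylinders s2 >> B -> P (A `&` B) = (P A * P B)%E.
Proof.
have fP C : measurable C -> P C \is a fin_num by move=> mC; exact: fin_num_measure.
have step1 (C : set T) : cylinders s2 C ->
    forall D, <<s cylinders s1 >> D -> P (D `&` C) = (P D * P C)%E.
  move=> cC; have mC := cylinders_measurable cC => D sD.
  have p0 : 0 <= fine (P C) by exact: fine_ge0.
  suff : mrestr P mC D = mscale (NngNum p0) P D.
    by rewrite /mrestr /mscale /= fineK ?fP// muleC.
  apply: (g_sigma_algebra_measure_unique (cylinders s1)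
    (@cylinders_measurable s1) (fun=> setT) (fun=> @cylinders_setT s1) _ _ _
    (@cylinders_setI s1)) => //.
  - by rewrite bigcup_const.
  - move=> E cE; change (P (E `&` C) = (fine (P C))%:E * P E)%E.
    by rewrite fineK ?fP// muleC indep_cylinders.
  - by move=> _; rewrite /= /mrestr setTI -ge0_fin_numE// fP.
move=> sA sB; have mA := sigma_cylinders_measurable sA.
have p0 : 0 <= fine (P A) by exact: fine_ge0.
suff : mrestr P mA B = mscale (NngNum p0) P B.
  by rewrite /mrestr /mscale /= setIC fineK ?fP.
apply: (g_sigma_algebra_measure_unique (cylinders s2)
  (@cylinders_measurable s2) (fun=> setT) (fun=> @cylinders_setT s2) _ _ _
  (@cylinders_setI s2)) => //.
- by rewrite bigcup_const.
- move=> E cE; change (P (E `&` A) = (fine (P A))%:E * P E)%E.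
  by rewrite fineK ?fP// setIC step1.
- by move=> _; rewrite /= /mrestr setTI -ge0_fin_numE// fP.
Qed.

Local Notation T1 := (g_sigma_algebraType (events_of s1)).
Local Notation T2 := (g_sigma_algebraType (events_of s2)).

Lemma events_of_measurable s (A : set T) : <<s events_of s >> A -> measurable A.
Proof.
by move=> sA; exact: sigma_cylinders_measurable (sigma_events_sub_cylinders sA).
Qed.

Lemma measurable_to_events s :
  measurable_fun setT (idfun : T -> g_sigma_algebraType (events_of s)).
Proof. by move=> _ A mA; rewrite setTI; exact: (@events_of_measurable s A mA). Qed.

Lemma measurable_diagonal : measurable_fun setT (fun w : T => (w : T1, w : T2)).
Proof. by apply/measurable_fun_pair; exact: measurable_to_events. Qed.

(** The diagonal w |-> (w, w) carries P to the product of its restrictions to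
    the sigma-algebras of the two blocks: this is independence, written on
    rectangles. Tonelli then lets the first coordinate be frozen while the
    second one is averaged, so a bound on every section of D holds on average
    along the diagonal. Working on copies of T avoids any joint law of random
    vectors. *)
Lemma freezing (D : set (T1 * T2)) (h : T1 -> R) (p : R) :
  measurable D -> measurable_fun setT h -> (forall w, 0 <= h w) -> 0 <= p ->
  (forall w : T1, p%:E <= P (xsection D w))%E ->
  (p%:E * \int[P]_w (h w)%:E <= \int[P]_w (h w * \1_D (w, w))%:E)%E.
Proof.
move=> mD mh h0 p0 pD.
pose i1 : {mfun T >-> T1} := HB.pack (idfun : T -> T1)
  (isMeasurableFun.Build _ _ _ _ _ (@measurable_to_events s1)).
pose i2 : {mfun T >-> T2} := HB.pack (idfun : T -> T2)
  (isMeasurableFun.Build _ _ _ _ _ (@measurable_to_events s2)).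
pose i12 : {mfun T >-> (T1 * T2)%type} := HB.pack (fun w : T => (w : T1, w : T2))
  (isMeasurableFun.Build _ _ _ _ _ measurable_diagonal).
pose P1 : probability T1 R := distribution P i1.
pose P2 : probability T2 R := distribution P i2.
pose P12 : probability (T1 * T2)%type R := distribution P i12.
have P12E (X12 : set (T1 * T2)) : measurable X12 -> (P1 \x P2)%E X12 = P12 X12.
  apply: product_measure_unique => A B mA mB.
  rewrite /P12 /P1 /P2 /distribution /pushforward /=.
  apply: indep_sigma_cylinders; exact: sigma_events_sub_cylinders.
pose F (z : T1 * T2) := (h z.1 * \1_D z)%:E.
have mF : measurable_fun setT F.
  apply/measurable_EFinP; apply: measurable_funM => //.
  by apply: (measurableT_comp mh); exact: measurable_fst.
have F0 z : (0 <= F z)%E by rewrite /F lee_fin mulr_ge0.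
have -> : (\int[P]_w (h w * \1_D (w, w))%:E = \int[P12]_z F z)%E.
  by rewrite ge0_integral_distribution.
rewrite (eq_measure_integral (P1 \x P2)%E); last first.
  by move=> A mA _; apply/esym/P12E.
rewrite fubini_tonelli1//.
have -> : (\int[P]_w (h w)%:E = \int[P1]_w (h w)%:E)%E.
  rewrite ge0_integral_distribution//; exact/measurable_EFinP.
rewrite -ge0_integralZl//; last 2 first.
- exact/measurable_EFinP.
- by move=> w _; rewrite lee_fin.
apply: ge0_le_integral => //.
- by move=> w _; rewrite mule_ge0// lee_fin.
- by apply: measurable_funeM; exact/measurable_EFinP.
- exact: measurable_fun_fubini_tonelli_F.
move=> w _; rewrite /fubini_F /F /=.
under eq_integral do rewrite EFinM.
rewrite (_ : (fun y => _) =
  fun y => ((h w)%:E * (\1_(xsection D w) y)%:E)%E); last first.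
  by apply/funext => y; rewrite !indicE mem_xsection.
have mDw : measurable (xsection D w) by exact: measurable_xsection.
rewrite ge0_integralZl//; last 2 first.
- by apply/measurable_EFinP; exact: measurable_indic.
- by rewrite lee_fin.
rewrite muleC lee_wpmul2l ?lee_fin//.
rewrite integral_indic// setIT; exact: pD.
Qed.

End independence.
(** * Euclidean norm, operator norm and quadratic forms *)

Section euclidean_theory.
Context {R : realType}.

Lemma dotvE n (u v : 'cV[R]_n) : dotv u v = \sum_i u i 0 * v i 0.
Proof. by rewrite /dotv mxE; apply: eq_bigr => i _; rewrite mxE. Qed.

Lemma dotvC n (u v : 'cV[R]_n) : dotv u v = dotv v u.
Proof. by rewrite !dotvE; apply: eq_bigr => i _; rewrite mulrC. Qed.

Lemma dotvDl n (u v w : 'cV[R]_n) : dotv (u + v) w = dotv u w + dotv v w.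
Proof. by rewrite /dotv linearD mulmxDl mxE. Qed.

Lemma dotvZl n a (u v : 'cV[R]_n) : dotv (a *: u) v = a * dotv u v.
Proof. by rewrite /dotv linearZ -scalemxAl mxE. Qed.

Lemma dotvNl n (u v : 'cV[R]_n) : dotv (- u) v = - dotv u v.
Proof. by rewrite -scaleN1r dotvZl mulN1r. Qed.

Lemma dotvBl n (u v w : 'cV[R]_n) : dotv (u - v) w = dotv u w - dotv v w.
Proof. by rewrite dotvDl dotvNl. Qed.

Lemma dotvZr n a (u v : 'cV[R]_n) : dotv u (a *: v) = a * dotv u v.
Proof. by rewrite !(dotvC u) dotvZl. Qed.

Lemma dotvNr n (u v : 'cV[R]_n) : dotv u (- v) = - dotv u v.
Proof. by rewrite !(dotvC u) dotvNl. Qed.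

Lemma dotvBr n (u v w : 'cV[R]_n) : dotv u (v - w) = dotv u v - dotv u w.
Proof. by rewrite !(dotvC u) dotvBl. Qed.

Lemma dotv0l n (v : 'cV[R]_n) : dotv 0 v = 0.
Proof. by rewrite -(scale0r 0) dotvZl mul0r. Qed.

Lemma dotv0r n (v : 'cV[R]_n) : dotv v 0 = 0.
Proof. by rewrite dotvC dotv0l. Qed.

Lemma dotv_mulmxr n p (A : 'M[R]_(n, p)) (u : 'cV[R]_n) (v : 'cV[R]_p) :
  dotv u (A *m v) = dotv (A^T *m u) v.
Proof. by rewrite /dotv trmx_mul trmxK mulmxA. Qed.

Lemma dotv_ge0 n (v : 'cV[R]_n) : 0 <= dotv v v.
Proof. by rewrite dotvE; apply: sumr_ge0 => i _; rewrite -expr2 sqr_ge0. Qed.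

Lemma dotvv_eq0 n (v : 'cV[R]_n) : (dotv v v == 0) = (v == 0).
Proof.
apply/eqP/eqP => [|->]; last by rewrite dotv0l.
rewrite dotvE => /eqP; rewrite psumr_eq0; last first.
  by move=> i _; rewrite -expr2 sqr_ge0.
move=> /allP v0; apply/colP => i; rewrite mxE.
by have := v0 i (mem_index_enum _); rewrite -expr2 sqrf_eq0 => /eqP.
Qed.

Lemma dotv_CauchySchwarz n (u v : 'cV[R]_n) :
  dotv u v ^+ 2 <= dotv u u * dotv v v.
Proof.
have [->|v0] := eqVneq v 0; first by rewrite !dotv0r expr0n mulr0.
have vv : 0 < dotv v v by rewrite lt_neqAle dotv_ge0 eq_sym dotvv_eq0 v0.
rewrite -ler_pdivrMr// -subr_ge0.
have := dotv_ge0 (u - (dotv u v / dotv v v) *: v).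
rewrite dotvBl !dotvBr !dotvZl !dotvZr (dotvC v u); congr (0 <= _).
by field; rewrite gt_eqF.
Qed.

Lemma enorm_ge0 n (v : 'cV[R]_n) : 0 <= enorm v.
Proof. exact: sqrtr_ge0. Qed.

Lemma enorm_sqr n (v : 'cV[R]_n) : enorm v ^+ 2 = dotv v v.
Proof. by rewrite sqr_sqrtr// dotv_ge0. Qed.

Lemma enorm_eq0 n (v : 'cV[R]_n) : (enorm v == 0) = (v == 0).
Proof. by rewrite -dotvv_eq0 -enorm_sqr sqrf_eq0. Qed.

Lemma enorm0 n : enorm (0 : 'cV[R]_n) = 0.
Proof. by apply/eqP; rewrite enorm_eq0. Qed.

Lemma enormZ n a (v : 'cV[R]_n) : enorm (a *: v) = `|a| * enorm v.
Proof.
rewrite /enorm dotvZl dotvZr mulrA -expr2.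
by rewrite sqrtrM ?sqr_ge0// sqrtr_sqr.
Qed.

Lemma dotv_le_enorm n (u v : 'cV[R]_n) : dotv u v <= enorm u * enorm v.
Proof.
rewrite /enorm -sqrtrM ?dotv_ge0// (le_trans (ler_norm _))//.
by rewrite -sqrtr_sqr ler_wsqrtr// dotv_CauchySchwarz.
Qed.

Lemma enorm_normalized n (v : 'cV[R]_n) : enorm (normalized v) <= 1.
Proof.
rewrite /normalized enormZ ger0_norm ?invr_ge0 ?enorm_ge0//.
by have [->|v0] := eqVneq (enorm v) 0; rewrite ?invr0 ?mul0r// mulVf.
Qed.

(** The square of the Frobenius norm. *)
Definition sqr_fro p q (A : 'M[R]_(p, q)) : R := \sum_i \sum_j A i j ^+ 2.

Lemma sqr_fro_ge0 p q (A : 'M[R]_(p, q)) : 0 <= sqr_fro A.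
Proof. by do 2![apply: sumr_ge0 => ? _]; exact: sqr_ge0. Qed.

Lemma sqr_froE p q (A : 'M[R]_(p, q)) : sqr_fro A = \tr (A^T *m A).
Proof.
rewrite /sqr_fro exchange_big; apply: eq_bigr => j _.
by rewrite mxE; apply: eq_bigr => i _; rewrite mxE.
Qed.

Lemma sqr_fro_cols p q (A : 'M[R]_(p, q)) :
  sqr_fro A = \sum_j enorm (col j A) ^+ 2.
Proof.
rewrite /sqr_fro exchange_big; apply: eq_bigr => j _.
by rewrite enorm_sqr dotvE; apply: eq_bigr => i _; rewrite mxE.
Qed.

Lemma sqr_entry_le_sqr_fro p q (A : 'M[R]_(p, q)) i j : A i j ^+ 2 <= sqr_fro A.
Proof.
rewrite /sqr_fro (bigD1 i)//= (bigD1 j)//= -addrA lerDl addr_ge0//.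
  by apply: sumr_ge0 => ? _; exact: sqr_ge0.
by do 2![apply: sumr_ge0 => ? _]; exact: sqr_ge0.
Qed.

Lemma sqr_enorm_mulmx_le p q (A : 'M[R]_(p, q)) (v : 'cV[R]_q) :
  enorm (A *m v) ^+ 2 <= sqr_fro A * enorm v ^+ 2.
Proof.
rewrite !enorm_sqr dotvE /sqr_fro mulr_suml; apply: ler_sum => i _.
have := dotv_CauchySchwarz (row i A)^T v.
have -> : dotv (row i A)^T v = (A *m v) i 0.
  by rewrite dotvE mxE; apply: eq_bigr => j _; rewrite !mxE.
have -> : dotv (row i A)^T (row i A)^T = \sum_j A i j ^+ 2.
  by rewrite dotvE; apply: eq_bigr => j _; rewrite !mxE expr2.
by rewrite expr2.
Qed.

Lemma opnorm_has_sup p q (A : 'M[R]_(p, q)) :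
  has_sup [set enorm (A *m v) | v in [set v : 'cV[R]_q | enorm v <= 1]].
Proof.
split; first by exists (enorm (A *m 0)), 0; rewrite //= enorm0.
exists (Num.sqrt (sqr_fro A)) => _ [v /= v1 <-].
rewrite -(ger0_norm (enorm_ge0 _)) -sqrtr_sqr ler_wsqrtr//.
rewrite (le_trans (sqr_enorm_mulmx_le _ _))// ler_piMr ?sqr_fro_ge0//.
by rewrite expr_le1// enorm_ge0.
Qed.

Lemma opnorm_leP p q (A : 'M[R]_(p, q)) K :
  opnorm A <= K <-> forall v, enorm v <= 1 -> enorm (A *m v) <= K.
Proof.
split => [AK v v1|AK].
  apply: le_trans AK; apply: ub_le_sup; last by exists v.
  by have [] := opnorm_has_sup A.
apply: ge_sup; first by have [] := opnorm_has_sup A.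
by move=> _ [v v1 <-]; exact: AK.
Qed.

Lemma enorm_mulmx_opnorm p q (A : 'M[R]_(p, q)) v :
  enorm (A *m v) <= opnorm A * enorm v.
Proof.
have [->|v0] := eqVneq v 0; first by rewrite mulmx0 !enorm0 mulr0.
have nv : 0 < enorm v by rewrite lt_neqAle enorm_ge0 eq_sym enorm_eq0 v0.
have /opnorm_leP/(_ (normalized v) (enorm_normalized v)) := lexx (opnorm A).
rewrite /normalized -scalemxAr enormZ ger0_norm ?invr_ge0 ?enorm_ge0//.
by rewrite mulrC ler_pdivrMr.
Qed.

Lemma sym_between_quad n (a b : R) (A : 'M[R]_n) v : sym_between a b A ->
  a * dotv v v <= dotv v (A *m v) <= b * dotv v v.
Proof.
move=> [_ /(_ v) + /(_ v)].
by rewrite !mulmxBl !dotvBr !mul_scalar_mx !dotvZr !subr_ge0 => -> ->.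
Qed.

(** This is A ^ 2 <= b A for 0 <= A <= b: the form of A is nonnegative at
    v - A v / b, and A <= b bounds the quadratic term of the expansion. *)
Lemma enorm_sym_between n (a b : R) (A : 'M[R]_n) v : 0 < a -> a <= b ->
  sym_between a b A -> enorm (A *m v) ^+ 2 <= b * dotv v (A *m v).
Proof.
move=> a0 ab HA; have b0 := lt_le_trans a0 ab; rewrite enorm_sqr.
have [sA _ _] := HA; pose w := A *m v.
have /andP[+ _] := sym_between_quad (v - b^-1 *: w) HA.
have /andP[_] := sym_between_quad w HA.
have vAw : dotv v (A *m w) = dotv w w by rewrite dotv_mulmxr sA.
have wAv : dotv w (A *m v) = dotv w w by [].
move=> hw h; have {h} : 0 <= dotv (v - b^-1 *: w) (A *m (v - b^-1 *: w)).
  by apply: le_trans h; rewrite mulr_ge0 ?dotv_ge0// ltW.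
rewrite mulmxBr -scalemxAr dotvBl !dotvBr !dotvZl !dotvZr vAw wAv => h.
have {}hw : b^-1 * (b^-1 * dotv w (A *m w)) <= b^-1 * dotv w w.
  by rewrite ler_wpM2l ?invr_ge0 ?(ltW b0)// ler_pdivrMl.
by rewrite -ler_pdivrMl// -/w; lra.
Qed.

End euclidean_theory.

(** * Clipping the spectrum of a symmetric matrix *)

Section spectral_clipping.
Context {R : realType}.

Lemma clip_bounds (a b t : R) : a <= b -> a <= clip a b t <= b.
Proof. by move=> ab; rewrite /clip le_max lexx ge_max ab ge_min lexx. Qed.

Lemma clip_dist (a b s t : R) : (clip a b s - clip a b t) ^+ 2 <= (s - t) ^+ 2.
Proof.
rewrite -(real_normK (num_real _)) -[leRHS](real_normK (num_real _)).
rewrite lerXn2r ?nnegrE// ler_norml /clip.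
have := ler_norm (s - t); have := ler_norm (t - s); rewrite (distrC t).
set dist := `|s - t| => ? ?; case: (leP b s) => ?; case: (leP b t) => ?;
  case: (leP a b) => ?; case: (leP a s) => ?; case: (leP a t) => ?;
  by apply/andP; split; lra.
Qed.

Lemma quad_diag n (U : 'M[R]_n) (l : 'rV[R]_n) v :
  dotv v (U *m diag_mx l *m U^T *m v) = \sum_i l 0 i * (U^T *m v) i 0 ^+ 2.
Proof.
rewrite -!mulmxA dotv_mulmxr dotvE; apply: eq_bigr => i _.
by rewrite mul_diag_mx !mxE; ring.
Qed.

Lemma clip_spectrum_between n (a b : R) (A B : 'M[R]_n) : a <= b ->
  clip_spectrum a b A B -> sym_between a b B.
Proof.
move=> ab [U [l [UU _ ->]]]; set l' := map_mx _ _.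
have UU' : U *m U^T = 1%:M by exact: mulmx1C.
have vv (v : 'cV[R]_n) : dotv v v = \sum_i (U^T *m v) i 0 ^+ 2.
  rewrite -{2}(mul1mx v) -UU' -mulmxA dotv_mulmxr dotvE.
  by apply: eq_bigr => i _; rewrite expr2.
split.
- by rewrite !trmx_mul trmxK tr_diag_mx mulmxA.
- move=> v; rewrite mulmxBl dotvBr mul_scalar_mx dotvZr quad_diag vv subr_ge0.
  rewrite mulr_sumr; apply: ler_sum => i _; rewrite ler_wpM2r ?sqr_ge0// mxE.
  by have /andP[] := clip_bounds (l 0 i) ab.
- move=> v; rewrite mulmxBl dotvBr mul_scalar_mx dotvZr quad_diag vv subr_ge0.
  rewrite mulr_sumr; apply: ler_sum => i _; rewrite ler_wpM2r ?sqr_ge0// mxE.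
  by have /andP[] := clip_bounds (l 0 i) ab.
Qed.

Lemma sqr_fro_orthogonal n (U V D : 'M[R]_n) :
  U *m U^T = 1%:M -> V *m V^T = 1%:M -> sqr_fro (U^T *m D *m V) = sqr_fro D.
Proof.
move=> UU VV; rewrite !sqr_froE !trmx_mul trmxK -!mulmxA mxtrace_mulC.
by rewrite !mulmxA -(mulmxA _ V) VV mulmx1 -(mulmxA _ U) UU mulmx1.
Qed.

(** In the two eigenbases, the difference U l U^T - V k V^T becomes l W - W k
    with W = U^T V, whose entries are (l_i - k_j) W_ij. *)
Lemma sqr_fro_spectral_diff n (U V : 'M[R]_n) (l k : 'rV[R]_n) :
  U^T *m U = 1%:M -> V^T *m V = 1%:M ->
  sqr_fro (U *m diag_mx l *m U^T - V *m diag_mx k *m V^T) =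
  \sum_i \sum_j (l 0 i - k 0 j) ^+ 2 * (U^T *m V) i j ^+ 2.
Proof.
move=> UU VV; have UU' := mulmx1C UU; have VV' := mulmx1C VV.
rewrite -(sqr_fro_orthogonal _ UU' VV') mulmxBr mulmxBl.
rewrite !mulmxA UU mul1mx -(mulmxA _ V^T) VV mulmx1 -(mulmxA (diag_mx l)).
apply: eq_bigr => i _; apply: eq_bigr => j _.
by rewrite mul_diag_mx mul_mx_diag !mxE -exprMn; congr (_ ^+ 2); ring.
Qed.

(** Clipping contracts every difference l_i - k_j in the formula above. In
    particular the clipped matrix depends only on the given one, and does so
    continuously; its measurability rests on this. *)
Lemma clip_spectrum_contraction n (a b : R) (A B A' B' : 'M[R]_n) :
  clip_spectrum a b A B -> clip_spectrum a b A' B' ->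
  sqr_fro (B - B') <= sqr_fro (A - A').
Proof.
move=> [U [l [UU -> ->]]] [V [k [VV -> ->]]].
rewrite !sqr_fro_spectral_diff//; apply: ler_sum => i _; apply: ler_sum => j _.
by rewrite !mxE ler_wpM2r ?sqr_ge0// clip_dist.
Qed.

End spectral_clipping.
(** * Gradients and the descent inequality *)

Section calculus.
Context {R : realType}.

Lemma cV_sum_delta n (v : 'cV[R]_n) : v = \sum_i v i 0 *: delta_mx i 0.
Proof.
by rewrite {1}[v]matrix_sum_delta; apply: eq_bigr => i _; rewrite big_ord1.
Qed.

Lemma derive_grad n (f : 'cV[R]_n -> R) x v :
  differentiable f x -> 'D_v f x = dotv (grad f x) v.
Proof.
move=> df; rewrite deriveE// {1}(cV_sum_delta v) linear_sum dotvE.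
by apply: eq_bigr => i _; rewrite linearZ/= -deriveE// mxE mulrC.
Qed.

Lemma grad_restricted n m (f : 'cV[R]_n -> R) x (P : 'M[R]_(n, m)) u :
  (forall x, differentiable f x) ->
  grad (restricted f x P) u = P^T *m grad f (x + P *m u).
Proof.
move=> df; apply/colP => i; rewrite mxE.
have -> : 'D_(delta_mx i 0) (restricted f x P) u =
          'D_(P *m delta_mx i 0) f (x + P *m u).
  rewrite /derive; set F := (X in lim (X @ _)); set G := (X in _ = lim (X @ _)).
  suff -> : F = G by [].
  by apply/funext => h; rewrite /F /G /restricted /= mulmxDr -scalemxAr addrCA.
rewrite derive_grad// dotvC /dotv trmx_mul trmx_delta -mulmxA.
by rewrite -rowE mxE.
Qed.

Lemma is_derive_along_line n (f : 'cV[R]_n -> R) x v t :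
  (forall x, differentiable f x) ->
  is_derive t (1 : R) (fun t => f (x + t *: v)) (dotv (grad f (x + t *: v)) v).
Proof.
move=> df.
have E : (fun h : R => h^-1 *: (f (x + (h *: 1 + t) *: v) - f (x + t *: v))) =
         (fun h : R => h^-1 *: (f (h *: v + (x + t *: v)) - f (x + t *: v))).
  by apply/funext => h; rewrite scalerDl -scalerA scale1r addrCA.
apply: DeriveDef; last first.
  by rewrite -derive_grad// /derive E.
have : derivable f (x + t *: v) v by exact: diff_derivable.
by rewrite /derivable -E.
Qed.

(** Along t |-> x + t v, the function f minus its quadratic model at x has
    derivative <grad f (x + t v) - grad f x, v> - L t |v|^2, which is
    nonpositive by Cauchy-Schwarz and the Lipschitz bound. *)
Lemma smooth_descent n (f : 'cV[R]_n -> R) (L : R) (x v : 'cV[R]_n) :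
  (forall x, differentiable f x) ->
  (forall u w, enorm (grad f u - grad f w) <= L * enorm (u - w)) ->
  f (x + v) <= f x + dotv (grad f x) v + L / 2 * enorm v ^+ 2.
Proof.
move=> df fL.
pose phi t : R := f (x + t *: v) -
  (t * dotv (grad f x) v + L / 2 * enorm v ^+ 2 * t ^+ 2).
pose dphi t : R := dotv (grad f (x + t *: v)) v -
  (dotv (grad f x) v + L * enorm v ^+ 2 * t).
have phiD t : is_derive t (1 : R) phi (dphi t).
  have lineD := is_derive_along_line x v t df.
  rewrite /phi; apply: is_derive_eq.
  by rewrite /dphi /GRing.scale /=; field.
have dphi_le0 t : 0 <= t -> dphi t <= 0.
  move=> t0; rewrite /dphi opprD addrA -dotvBl subr_le0.
  rewrite (le_trans (dotv_le_enorm _ _))// expr2 mulrA mulrAC ler_wpM2r ?enorm_ge0//.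
  rewrite (le_trans (fL _ _))// addrC addKr enormZ ger0_norm//.
  by rewrite mulrA mulrAC.
have : phi 1 <= phi 0.
  apply: (@ler0_derive1_nincr _ phi 0 1) => //.
  - move=> t; rewrite in_itv/= => /andP[t0 _].
    by rewrite derive1E; have [_ ->] := phiD t; rewrite dphi_le0// ltW.
  - apply: continuous_subspaceT => t.
    by apply: differentiable_continuous; apply/derivable1_diffP; have [] := phiD t.
rewrite /phi !scale1r scale0r addr0 mul1r mul0r expr1n expr0n/= mulr0 mulr1.
by rewrite addr0 subr0; lra.
Qed.

End calculus.
(** * Measurability of matrix-valued maps *)

Section inverse_measurable.
Context {R : realType}.

Lemma measurable_funV d (T : measurableType d) (f : T -> R) :
  measurable_fun setT f -> measurable_fun setT (fun w => (f w)^-1).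
Proof.
move=> mf; apply: (measurableT_comp (f := @GRing.inv R)) => //.
have -> : @GRing.inv R = fun x => if x == 0 then 0 else x^-1.
  by apply/funext => x; case: eqP => // ->; rewrite invr0.
apply: measurable_fun_if => //.
  by apply: measurable_fun_eqr => //; exact: measurable_cst.
rewrite setTI (_ : _ @^-1` _ = [set x : R | x != 0]); last first.
  by apply/seteqP; split => x /=; case: eqP.
apply: open_continuous_measurable_fun; first exact: open_neq.
by move=> x; rewrite inE /= => x0; exact: inv_continuous.
Qed.

End inverse_measurable.

Section measurable_matrices.
Context d {T : measurableType d} {R : realType}.

(** Stated on the entries, which are real-valued, so that no sigma-algebra on
    the type of matrices has to be chosen. *)
Definition measurable_mx p q (X : T -> 'M[R]_(p, q)) :=
  forall i j, measurable_fun setT (fun w => X w i j).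

Lemma measurable_mx_cst p q (A : 'M[R]_(p, q)) : measurable_mx (fun=> A).
Proof. by move=> i j; exact: measurable_cst. Qed.

Lemma measurable_mxD p q (X Y : T -> 'M[R]_(p, q)) :
  measurable_mx X -> measurable_mx Y -> measurable_mx (fun w => X w + Y w).
Proof.
move=> mX mY i j; under eq_fun do rewrite mxE.
exact: measurable_funD.
Qed.

Lemma measurable_mxN p q (X : T -> 'M[R]_(p, q)) :
  measurable_mx X -> measurable_mx (fun w => - X w).
Proof.
move=> mX i j; under eq_fun do rewrite mxE.
exact: measurable_funN.
Qed.

Lemma measurable_mxB p q (X Y : T -> 'M[R]_(p, q)) :
  measurable_mx X -> measurable_mx Y -> measurable_mx (fun w => X w - Y w).
Proof. by move=> mX mY; apply: measurable_mxD => //; exact: measurable_mxN. Qed.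

Lemma measurable_mxZ p q (a : T -> R) (X : T -> 'M[R]_(p, q)) :
  measurable_fun setT a -> measurable_mx X ->
  measurable_mx (fun w => a w *: X w).
Proof.
move=> ma mX i j; under eq_fun do rewrite mxE.
exact: measurable_funM.
Qed.

Lemma measurable_mxT p q (X : T -> 'M[R]_(p, q)) :
  measurable_mx X -> measurable_mx (fun w => (X w)^T).
Proof. by move=> mX i j; under eq_fun do rewrite mxE; exact: mX. Qed.

Lemma measurable_mxM p q r (X : T -> 'M[R]_(p, q)) (Y : T -> 'M[R]_(q, r)) :
  measurable_mx X -> measurable_mx Y -> measurable_mx (fun w => X w *m Y w).
Proof.
move=> mX mY i j; under eq_fun do rewrite mxE.
by apply: measurable_sum => k; exact: measurable_funM.
Qed.

Lemma measurable_dotv n (X Y : T -> 'cV[R]_n) :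
  measurable_mx X -> measurable_mx Y ->
  measurable_fun setT (fun w => dotv (X w) (Y w)).
Proof.
by move=> mX mY; apply: measurable_mxM => //; exact: measurable_mxT.
Qed.

Lemma measurable_enorm n (X : T -> 'cV[R]_n) :
  measurable_mx X -> measurable_fun setT (fun w => enorm (X w)).
Proof.
move=> mX; apply: (@measurableT_comp _ _ _ _ _ _ (@Num.sqrt R) _
    (fun w => dotv (X w) (X w))); last exact: measurable_dotv.
apply: continuous_measurable_fun; exact: sqrt_continuous.
Qed.

Lemma measurable_normalized n (X : T -> 'cV[R]_n) :
  measurable_mx X -> measurable_mx (fun w => normalized (X w)).
Proof.
move=> mX; apply: measurable_mxZ => //; apply: measurable_funV.
exact: measurable_enorm.
Qed.

Lemma measurable_push_cols n m (X : T -> 'M[R]_(n, m)) (u v : T -> 'cV[R]_n) :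
  measurable_mx X -> measurable_mx u -> measurable_mx v ->
  measurable_mx (fun w => push_cols (X w) (u w) (v w)).
Proof.
move=> mX mu mv i j; under eq_fun do rewrite mxE.
case: (insub _ : option 'I_m) => [j'|]; first exact: mX.
by case: (odd j); [exact: mv|exact: mu].
Qed.

Lemma measurable_bfgs m (H : T -> 'M[R]_m) (s y : T -> 'cV[R]_m) :
  measurable_mx H -> measurable_mx s -> measurable_mx y ->
  measurable_mx (fun w => bfgs (H w) (s w) (y w)).
Proof.
move=> mH ms my.
have mV : measurable_fun setT (fun w => (dotv (s w) (y w))^-1).
  by apply: measurable_funV; exact: measurable_dotv.
have mouter (u v : T -> 'cV[R]_m) : measurable_mx u -> measurable_mx v ->
    measurable_mx (fun w => (dotv (s w) (y w))^-1 *: (u w *m (v w)^T)).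
  move=> mu mv; apply: measurable_mxZ => //; apply: measurable_mxM => //.
  exact: measurable_mxT.
apply: measurable_mxD; last exact: mouter.
apply: measurable_mxM; [apply: measurable_mxM => //|].
  by apply: measurable_mxB; [exact: measurable_mx_cst|exact: mouter].
by apply: measurable_mxB; [exact: measurable_mx_cst|exact: mouter].
Qed.

(** Entrywise measurability is Borel measurability: an open set of matrices is
    the union of the balls it contains with rational centre and radius
    1 / (k + 1), and each ball is a finite intersection of conditions on the
    entries. *)
Lemma measurable_mx_open p q (X : T -> 'M[R]_(p, q)) (O : set 'M[R]_(p, q)) :
  measurable_mx X -> open O -> measurable (X @^-1` O).
Proof.
move=> mX oO.
pose B (ck : 'M[rat]_(p, q) * nat) : set 'M[R]_(p, q) :=
  ball (map_mx ratr ck.1 : 'M[R]_(p, q)) ck.2.+1%:R^-1.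
have -> : O = \bigcup_ck (if `[< B ck `<=` O >] then B ck else set0).
  apply/seteqP; split => [A OA|A [ck _]]; last first.
    by case: ifPn => // /asboolP; exact.
  have /nbhs_ballP[_/posnumP[e] eO] : nbhs A O by exact: open_nbhs_nbhs.
  have [k _ /(_ k (leqnn _)) ke] := near_infty_natSinv_lt (e%:num / 2)%:pos.
  have k0 : 0 < k.+1%:R^-1 :> R by [].
  have dense_entry i j : exists r : rat, `|A i j - ratr r| < k.+1%:R^-1.
    have [r] : exists r : rat, ratr r \in
        `]A i j - k.+1%:R^-1, A i j + k.+1%:R^-1[.
      by apply: rat_in_itvoo; rewrite ltrBlDr -addrA ltrDl addr_gt0.
    by rewrite in_itv/= => Ar; exists r; rewrite ltr_distlC.
  have [c cA] := choice (fun ij : 'I_p * 'I_q => dense_entry ij.1 ij.2).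
  exists (\matrix_(i, j) c (i, j), k) => //.
  case: ifPn => [_|/asboolP].
    by split => // i j; rewrite !mxE /ball /= distrC; exact: (cA (i, j)).
  apply: contra_notP => _ D [_ BD]; apply: eO; split => // i j.
  have := BD i j; have := cA (i, j); rewrite !mxE /ball/= => AB BD'.
  rewrite (le_lt_trans (ler_distD (ratr (c (i, j))) _ _))//.
  by rewrite [ltRHS]splitr; apply: ltrD; [exact: lt_trans AB _|exact: lt_trans BD' _].
rewrite preimage_bigcup; apply: countable_bigcupT_measurable => // ck.
case: ifP => // _; last by rewrite preimage_set0.
have -> : X @^-1` B ck = \bigcap_(ij in [set: 'I_p * 'I_q])
    (fun w => X w ij.1 ij.2) @^-1` ball (ratr (ck.1 ij.1 ij.2) : R) ck.2.+1%:R^-1.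
  apply/seteqP; split => w /=.
    by move=> [_ Bw] [i j] _; have := Bw i j; rewrite mxE.
  by move=> Bw; split => // i j; rewrite mxE; exact: (Bw (i, j)).
apply: fin_bigcap_measurable; first exact: finite_finset.
move=> [i j] _; rewrite -[X in measurable X]setTI.
by apply: mX => //; exact: measurable_ball.
Qed.

Lemma measurable_continuous_comp n (f : 'cV[R]_n -> R) (X : T -> 'cV[R]_n) :
  continuous f -> measurable_mx X -> measurable_fun setT (fun w => f (X w)).
Proof.
move=> cf mX; apply: (measurability _ (RGenOpens.measurableE R)).
move=> _ [_ [a [b ->] <-]]; rewrite setTI.
apply: (measurable_mx_open (O := f @^-1` `]a, b[%classic)) => //.
by move/continuousP : cf; apply; exact: interval_open.
Qed.

Lemma measurable_mx_continuous_comp n p q (F : 'cV[R]_n -> 'M[R]_(p, q))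
    (X : T -> 'cV[R]_n) :
  continuous F -> measurable_mx X -> measurable_mx (fun w => F (X w)).
Proof.
move=> cF mX i j; apply: (measurable_continuous_comp (f := fun v => F v i j)) => //.
move=> v; apply: (@continuous_comp _ _ _ F (fun A : 'M[R]_(p, q) => A i j)).
  exact: cF.
exact: coord_continuous.
Qed.

Lemma continuous_sqr_fro_sub p q (A0 : 'M[R]_(p, q)) :
  continuous (fun A : 'M[R]_(p, q) => sqr_fro (A - A0)).
Proof.
have cadd : continuous (fun x : R * R => x.1 + x.2) by exact: add_continuous.
rewrite /sqr_fro; apply: (continuous_big (op := +%R)) => // i _.
apply: (continuous_big (op := +%R)) => // j _ A.
have cA : {for A, continuous (fun A : 'M[R]_(p, q) => A i j - A0 i j)}.
  apply: continuousB; first exact: coord_continuous.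
  exact: cst_continuous.
rewrite (_ : (fun _ => _) = (fun A : 'M[R]_(p, q) =>
    (A i j - A0 i j) * (A i j - A0 i j))); first exact: (continuousM cA cA).
by apply/funext => M; rewrite !mxE expr2.
Qed.

(** On D the map Y is a contraction of X. So the part of D where x < Y i j is
    the part where X lies in the union, over the points w0 of D with
    x < Y w0 i j, of the Frobenius balls about X w0 of radius Y w0 i j - x,
    and this union is open. *)
Lemma measurable_clip_spectrum n (a b : R) (D : set T) (X Y : T -> 'M[R]_n) :
  measurable_mx X -> (forall w, D w -> clip_spectrum a b (X w) (Y w)) ->
  forall i j, measurable_fun D (fun w => Y w i j).
Proof.
move=> mX XY i j mD; apply: (measurability _ (RGenOInfty.measurableE R)) => //.
move=> _ [_ [x ->] <-].
pose near_pt (w0 : T) : set 'M[R]_n :=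
  [set A | sqr_fro (A - X w0) < (Y w0 i j - x) ^+ 2].
pose O := \bigcup_(w0 in [set w | D w /\ x < Y w i j]) near_pt w0.
rewrite (_ : _ `&` _ = D `&` X @^-1` O).
  apply: measurableI => //; apply: measurable_mx_open => //.
  apply: bigcup_open => w0 _; rewrite /near_pt.
  have /continuousP := continuous_sqr_fro_sub (A0 := X w0).
  by move=> /(_ _ (@open_lt R ((Y w0 i j - x) ^+ 2))).
apply/seteqP; split => w /=; rewrite in_itv/= andbT.
  move=> [Dw xw]; split => //; exists w => //.
  rewrite /near_pt /= subrr /sqr_fro big1 ?exprn_gt0 ?subr_gt0//.
  by move=> ? _; rewrite big1// => ? _; rewrite mxE expr0n.
move=> [Dw [w0 [Dw0 xw0]]]; rewrite /near_pt /= => near_w; split => //.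
have {near_w} :=
  le_lt_trans (clip_spectrum_contraction (XY _ Dw) (XY _ Dw0)) near_w.
move=> /(le_lt_trans (sqr_entry_le_sqr_fro _ i j)); rewrite !mxE.
by move=> lt_sqr; rewrite ltNge; apply/negP => ?; nra.
Qed.

Lemma continuous_enorm_mulmx p q (v : 'cV[R]_q) :
  continuous (fun A : 'M[R]_(p, q) => enorm (A *m v)).
Proof.
have cadd : continuous (fun x : R * R => x.1 + x.2) by exact: add_continuous.
have cAv i : continuous (fun A : 'M[R]_(p, q) => (A *m v) i 0).
  under eq_fun do rewrite mxE.
  apply: (continuous_big (op := +%R)) => // j _ A.
  apply: (@continuousM R _ (fun A : 'M[R]_(p, q) => A i j) (fun=> v j 0)).
    exact: coord_continuous.
  exact: cst_continuous.
have cdot : continuous (fun A : 'M[R]_(p, q) => dotv (A *m v) (A *m v)).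
  rewrite (_ : (fun _ => _) = (fun A : 'M[R]_(p, q) =>
      \sum_i (A *m v) i 0 * (A *m v) i 0)); last first.
    by apply/funext => A; rewrite dotvE.
  apply: (continuous_big (op := +%R)) => // i _ A.
  exact: (continuousM (cAv i A) (cAv i A)).
move=> A; apply: (@continuous_comp _ _ _
  (fun A : 'M[R]_(p, q) => dotv (A *m v) (A *m v)) (@Num.sqrt R)).
  exact: cdot.
exact: sqrt_continuous.
Qed.

(** The operator norm is a supremum over uncountably many vectors, but the
    matrices it bounds by K form a closed set. *)
Lemma measurable_opnorm_le p q (X : T -> 'M[R]_(p, q)) K :
  measurable_mx X -> measurable [set w | opnorm (X w) <= K].
Proof.
move=> mX.
pose C := \bigcap_(v in [set v : 'cV[R]_q | enorm v <= 1])
  [set A : 'M[R]_(p, q) | enorm (A *m v) <= K].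
have cC : closed C.
  apply: closed_bigI => v _.
  have /continuous_closedP := @continuous_enorm_mulmx p q v.
  by move=> /(_ _ (@closed_le R K)).
rewrite (_ : mkset _ = ~` (X @^-1` (~` C))).
  apply: measurableC; apply: measurable_mx_open => //; exact: closed_openC.
rewrite preimage_setC setCK; apply/seteqP; split => w /=.
  by move=> /opnorm_leP XK v v1; exact: XK.
by move=> XK; apply/opnorm_leP => v v1; exact: XK.
Qed.

End measurable_matrices.
(** * One step of the method *)

Section columns.
Context {R : realType}.

Definition cols_le1 n m (P : 'M[R]_(n, m)) := forall j, enorm (col j P) <= 1.

Lemma col_push_cols n m (P : 'M[R]_(n, m)) u v j :
  col j (push_cols P u v) =
  if insub j.+2 is Some j' then col j' P else if odd j then v else u.
Proof.
apply/colP => i; rewrite !mxE.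
by case: (insub _ : option 'I_m) => [j'|]; [rewrite mxE|case: (odd j)].
Qed.

Lemma cols_le1_push_cols n m (P : 'M[R]_(n, m)) u v :
  cols_le1 P -> enorm u <= 1 -> enorm v <= 1 -> cols_le1 (push_cols P u v).
Proof.
move=> P1 u1 v1 j; rewrite col_push_cols.
by case: (insub _ : option 'I_m) => [j'|]; [exact: P1|case: (odd j)].
Qed.

(** The appended columns occupy the indices m - 2 (even) and m - 1 (odd). *)
Lemma last_col_push_cols n m (P : 'M[R]_(n, m)) u v :
  (0 < m)%N -> ~~ odd m -> exists j, col j (push_cols P u v) = v.
Proof.
case: m P => // m P _ /=; rewrite negbK => om; exists ord_max.
by rewrite col_push_cols /= insubF ?om// ltnNge leqnSn.
Qed.

Lemma enorm_mulmx_cols n m (P : 'M[R]_(n, m)) v :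
  cols_le1 P -> enorm (P *m v) ^+ 2 <= m%:R * enorm v ^+ 2.
Proof.
move=> P1; rewrite (le_trans (sqr_enorm_mulmx_le _ _))// ler_wpM2r ?sqr_ge0//.
have -> : m%:R = \sum_(j < m) (1 : R) by rewrite sumr_const card_ord.
rewrite sqr_fro_cols.
by apply: ler_sum => j _; rewrite expr_le1 ?enorm_ge0.
Qed.

Lemma dotv_col_le n m (P : 'M[R]_(n, m)) g j :
  dotv (col j P) g ^+ 2 <= enorm (P^T *m g) ^+ 2.
Proof.
have -> : dotv (col j P) g = (P^T *m g) j 0.
  by rewrite dotvE mxE; apply: eq_bigr => i _; rewrite !mxE.
by rewrite enorm_sqr dotvE (bigD1 j)//= expr2 lerDl sumr_ge0// => i _;
  rewrite -expr2 sqr_ge0.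
Qed.

End columns.

Lemma alpha_bar_ge0 {R : realType} m (beta c M1 M2 L : R) :
  M1 <= M2 -> 0 < beta < 1 -> 0 < c < 1 -> 0 < M1 -> 0 < L ->
  0 <= alpha_bar m beta c M2 L.
Proof.
move=> M12 /andP[b0 _] /andP[_ c1] M10 L0; have M20 := lt_le_trans M10 M12.
rewrite /alpha_bar le_min ler01 divr_ge0//.
  by rewrite !mulr_ge0 ?subr_ge0 ?(ltW b0) ?(ltW c1).
by rewrite !mulr_ge0 ?(ltW M20) ?(ltW L0).
Qed.

Lemma decrease_factor_ge0 {R : realType} m (beta c M1 M2 L : R) :
  M1 <= M2 -> 0 < beta < 1 -> 0 < c < 1 -> 0 < M1 -> 0 < L ->
  0 <= c * alpha_bar m beta c M2 L * M1.
Proof.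
move=> M12 beta01 /andP[c0 c1] M10 L0; apply: mulr_ge0 (ltW M10).
apply: mulr_ge0 (ltW c0) _.
by apply: (@alpha_bar_ge0 _ m beta c M1) => //; rewrite c0.
Qed.

Section armijo_step.
Context {R : realType} (n m : nat) (f : 'cV[R]_n -> R) (beta c M1 M2 L : R).
Hypothesis df : forall x, differentiable f x.
Hypothesis f_smooth : forall u v, enorm (grad f u - grad f v) <= L * enorm (u - v).
Hypotheses (beta01 : 0 < beta < 1) (c01 : 0 < c < 1).
Hypotheses (M1_gt0 : 0 < M1) (M12 : M1 <= M2) (L_gt0 : 0 < L) (m_gt0 : (0 < m)%N).
Variables (x : 'cV[R]_n) (P : 'M[R]_(n, m)) (H : 'M[R]_m) (a : R).
Hypotheses (P1 : cols_le1 P) (HM : sym_between M1 M2 H).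

(* G is the gradient of the restricted function at 0 and -q its slope along the
   search direction. *)
Let G := P^T *m grad f x.
Let dir := - (H *m grad (restricted f x P) 0).
Let q := dotv G (H *m G).

Hypothesis a_first : first_power beta (armijo f c x P dir) a.

Let M2_gt0 : 0 < M2. Proof. exact: lt_le_trans M12. Qed.

Let grad0 : grad (restricted f x P) 0 = G.
Proof. by rewrite grad_restricted// mulmx0 addr0. Qed.

Let dirE : dir = - (H *m G). Proof. by rewrite /dir grad0. Qed.

Let slope : dotv (grad (restricted f x P) 0) dir = - q.
Proof. by rewrite grad0 dirE dotvNr. Qed.

Let q_ge : M1 * enorm G ^+ 2 <= q.
Proof. by rewrite enorm_sqr; have /andP[] := sym_between_quad G HM. Qed.

Let q_ge0 : 0 <= q.
Proof. by apply: le_trans q_ge; rewrite mulr_ge0 ?sqr_ge0// ltW. Qed.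

Let enorm_dir : enorm (P *m dir) ^+ 2 <= m%:R * (M2 * q).
Proof.
rewrite (le_trans (enorm_mulmx_cols _ P1))// ler_wpM2l//.
rewrite dirE enorm_sqr dotvNl dotvNr opprK -enorm_sqr.
exact: (enorm_sym_between _ M1_gt0 M12).
Qed.

(** If the step b fails the sufficient decrease test, the margin (1 - c) b q
    left by the test is smaller than the curvature term of the descent
    inequality, at most L b^2 / 2 * |P dir|^2 <= L b^2 / 2 * m M2 q. The factor
    q cancels: it cannot be 0, since the inequality is strict. *)
Lemma failed_step_gt b : 0 < b -> ~ armijo f c x P dir b ->
  2 * (1 - c) / (m%:R * M2 * L) < b.
Proof.
move=> b0; rewrite /armijo slope /restricted mulmx0 addr0 => /negP.
rewrite -ltNge => fail.
have := smooth_descent x (b *: (P *m dir)) df f_smooth.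
have -> : dotv (grad f x) (b *: (P *m dir)) = - (b * q).
  by rewrite dotvZr dotv_mulmxr dirE dotvNr mulrN.
rewrite enormZ ger0_norm ?(ltW b0)// exprMn => desc.
have mM2L : 0 < m%:R * M2 * L by rewrite !mulr_gt0 ?ltr0n ?M2_gt0.
have Lb : L / 2 * (b ^+ 2 * enorm (P *m dir) ^+ 2) <=
          L / 2 * (b ^+ 2 * (m%:R * (M2 * q))).
  by rewrite ler_wpM2l ?divr_ge0 ?(ltW L_gt0)// ler_wpM2l ?sqr_ge0 ?enorm_dir.
have key : b * ((1 - c) * q) < b * (m%:R * M2 * L * b / 2 * q) by nra.
move: key; rewrite ltr_pM2l// => key.
have {}key : 1 - c < m%:R * M2 * L * b / 2.
  by rewrite ltNge; apply/negP => le; have := ler_wpM2r q_ge0 le; lra.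
by rewrite ltr_pdivrMr//; lra.
Qed.

(** Either the first trial step 1 is accepted, or the step a / beta failed. *)
Lemma alpha_bar_le : alpha_bar m beta c M2 L <= a.
Proof.
have [i [-> _ no_before]] := a_first; have /andP[b0 b1] := beta01.
rewrite /alpha_bar ge_min; case: i no_before => [|i] no_before.
  by rewrite expr0 lexx.
apply/orP; right; rewrite exprS.
have /failed_step_gt : ~ armijo f c x P dir (beta ^+ i) by exact: no_before.
move=> /(_ (exprn_gt0 _ b0)) /ltW; rewrite -(ler_pM2l b0).
by apply: le_trans; rewrite le_eqVlt; apply/orP; left; apply/eqP; ring.
Qed.

Lemma armijo_decrease :
  f (x + a *: (P *m dir)) + c * alpha_bar m beta c M2 L * M1 * enorm G ^+ 2 <= f x.
Proof.
have a_ge := alpha_bar_le; have /andP[c0 _] := c01.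
have [i [aE + _]] := a_first; rewrite -aE /armijo slope /restricted mulmx0 addr0.
move=> decr; rewrite (le_trans (lerD decr (lexx _)))//.
rewrite -addrA gerDl mulrN addrC subr_le0 -!mulrA !ler_wpM2l ?(ltW c0)//.
have a0 := alpha_bar_ge0 m M12 beta01 c01 M1_gt0 L_gt0.
by apply: ler_pM => //; rewrite mulr_ge0 ?sqr_ge0// ltW.
Qed.

End armijo_step.

Section sketching.
Context {R : realType} (n d : nat).
Hypotheses (d_gt0 : (0 < d)%N) (n_gt0 : (0 < n)%N).

(** On this event the direction Q Q^T g captures a fixed proportion of g. *)
Definition well_conditioned (C eps : R) (Q : 'M[R]_(n, d)) (g : 'cV[R]_n) :=
  (1 - eps) * enorm g ^+ 2 <=
    enorm ((Num.sqrt d%:R)^-1 *: (Q^T *m g)) ^+ 2 <= (1 + eps) * enorm g ^+ 2 /\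
  d%:R^-1 * opnorm (Q *m Q^T) <= C * (n%:R / d%:R).

(** The component of g along Q Q^T g is |Q^T g|^2 / |Q Q^T g|; the numerator is
    at least (1 - eps) d |g|^2 and the denominator at most C n |g|. *)
Lemma well_conditioned_projection (C eps : R) Q g : 0 < C -> 0 < eps < 1 ->
  well_conditioned C eps Q g ->
  ((1 - eps) * d%:R / (C * n%:R)) ^+ 2 * enorm g ^+ 2 <=
  dotv (normalized (Q *m Q^T *m g)) g ^+ 2.
Proof.
move=> C0 /andP[e0 e1] [/andP[low _] upp].
have [->|g0] := eqVneq g 0; first by rewrite enorm0 expr0n mulr0 sqr_ge0.
have ng : 0 < enorm g by rewrite lt_neqAle enorm_ge0 eq_sym enorm_eq0 g0.
have dR : 0 < d%:R :> R by rewrite ltr0n.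
have nR : 0 < n%:R :> R by rewrite ltr0n.
have {}low : (1 - eps) * d%:R * enorm g ^+ 2 <= dotv (Q *m Q^T *m g) g.
  rewrite -mulmxA dotvC dotv_mulmxr -enorm_sqr.
  move: low; rewrite enormZ exprMn ger0_norm ?invr_ge0 ?sqrtr_ge0// exprVn.
  rewrite (sqr_sqrtr (ltW dR)) -(ler_pM2l dR) => low.
  by rewrite mulrAC mulrC (le_trans low)// mulVKf ?gt_eqF.
have {}upp : enorm (Q *m Q^T *m g) <= C * n%:R * enorm g.
  rewrite (le_trans (enorm_mulmx_opnorm _ _))// ler_pM2r//.
  by move: upp; rewrite mulrC ler_pdivrMr// -mulrA mulfVK ?gt_eqF.
have lowpos : 0 < (1 - eps) * d%:R * enorm g ^+ 2.
  by rewrite !mulr_gt0 ?subr_gt0 ?exprn_gt0.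
have Qg : 0 < enorm (Q *m Q^T *m g).
  rewrite lt_neqAle enorm_ge0 eq_sym enorm_eq0 andbT.
  by apply: contraTneq low => ->; rewrite dotv0l -ltNge.
rewrite -exprMn lerXn2r ?nnegrE//.
- by rewrite !mulr_ge0 ?invr_ge0 ?mulr_ge0 ?subr_ge0 ?(ltW e1) ?(ltW C0) ?(ltW ng).
- by rewrite dotvZl mulr_ge0 ?invr_ge0 ?enorm_ge0// (le_trans (ltW lowpos)).
rewrite dotvZl mulrC ler_pdivlMl// (le_trans _ low)//.
rewrite (le_trans (ler_wpM2r _ upp))//.
  by rewrite !mulr_ge0 ?invr_ge0 ?mulr_ge0 ?subr_ge0 ?(ltW e1) ?(ltW C0) ?(ltW ng).
rewrite le_eqVlt; apply/orP; left; apply/eqP; field.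
by rewrite !gt_eqF.
Qed.

End sketching.
(** * Measurability of the iterates *)

Section first_power.
Context d {T : measurableType d} {R : realType}.

Lemma measurable_first_power (beta : R) (A : T -> R -> Prop) (a : T -> R) :
  (forall i, measurable [set w | A w (beta ^+ i)]) ->
  (forall w, first_power beta (A w) (a w)) -> measurable_fun setT a.
Proof.
move=> mA aP _ B mB; rewrite setTI.
pose D i := [set w | A w (beta ^+ i)] `&`
  \bigcap_(j in [set j | (j < i)%N]) ~` [set w | A w (beta ^+ j)].
rewrite (_ : a @^-1` B = \bigcup_i (if beta ^+ i \in B then D i else set0)).
  apply: bigcupT_measurable => i; case: ifP => // _; apply: measurableI => //.
  by apply: bigcap_measurableType => j _; exact: measurableC.
apply/seteqP; split => w /=.
  have [i [-> Ai nAj]] := aP w => Bi; exists i => //.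
  by rewrite mem_set//; split.
have [i [-> Ai nAj]] := aP w => -[j _]; case: ifPn => // /set_mem Bj [Aj nAi].
suff -> : i = j by [].
by case: (ltngtP i j) => // [/nAi|/nAj].
Qed.

End first_power.

Section entries.
Variables (n d : nat).

Definition entries (s : seq nat) : seq (nat * 'I_n * 'I_d) :=
  [seq (l, ij.1, ij.2) | l <- s, ij <- enum {: 'I_n * 'I_d}].

Lemma mem_entries s e : (e \in entries s) = (e.1.1 \in s).
Proof.
case: e => [[l i] j]; apply/allpairsP/idP => [[[l' ij] /= [ls _ [-> _ _]]] //|ls].
by exists (l, (i, j)); split; rewrite ?mem_enum.
Qed.

Lemma uniq_entries s : uniq s -> uniq (entries s).
Proof.
move=> us; apply: allpairs_uniq => //; first exact: enum_uniq.
by move=> [l [i j]] [l' [i' j']] _ _ /= [-> -> ->].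
Qed.

Lemma uniq_entries_cat s t : uniq (s ++ t) -> uniq (entries s ++ entries t).
Proof.
rewrite !cat_uniq => /and3P[us /hasPn st ut].
rewrite !uniq_entries// andbT; apply/hasPn => e.
by rewrite /= !mem_entries => /st.
Qed.

End entries.
Section gaussian_blocks.
Context d0 {T : measurableType d0} {R : realType} (P : probability T R).
Context (n d : nat) (Q : nat -> 'I_n -> 'I_d -> {RV P >-> R}).

Definition entry_of (e : nat * 'I_n * 'I_d) : {RV P >-> R} := Q e.1.1 e.1.2 e.2.

Definition past (k : nat) := events_of entry_of (entries n d (iota 0 k)).
Definition present (k : nat) := events_of entry_of (entries n d [:: k]).

Lemma measurable_mx_past_step k p q (X : T -> 'M[R]_(p, q)) :
  @measurable_mx _ (g_sigma_algebraType (past k)) R p q X ->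
  @measurable_mx _ (g_sigma_algebraType (past k.+1)) R p q X.
Proof.
move=> mX i j _ B mB.
have incl : past k `<=` past k.+1.
  move=> A [e]; rewrite mem_entries mem_iota => /andP[_ ek] eA.
  by exists e => //; rewrite mem_entries mem_iota /= ltnW.
exact: (sub_sigma_algebra2 incl (mX i j measurableT B mB)).
Qed.

Lemma measurable_mx_rmx s k : k \in s ->
  @measurable_mx _ (g_sigma_algebraType (events_of entry_of (entries n d s)))
    R n d (rmx (Q k)).
Proof.
move=> ks i j _ B mB; under eq_fun do rewrite mxE.
apply: sub_sigma_algebra; exists (k, i, j); first by rewrite mem_entries.
by exists B.
Qed.

Lemma history_measurable_past k p q (B : T -> 'M[R]_(p, q)) :
  history_measurable Q k B ->
  @measurable_mx _ (g_sigma_algebraType (past k.+1)) R p q B.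
Proof.
move=> hB i j _ A mA.
have hA : history Q k (setT `&` (fun w => B w i j) @^-1` A).
  by apply: (hB i j); exists A.
apply: (sub_sigma_algebra2 _ hA) => C [l [i' [j' [lk lC]]]].
by exists (l, i', j') => //; rewrite mem_entries mem_iota.
Qed.

Lemma measurable_past k (A : set T) : <<s past k >> A -> measurable A.
Proof. exact: events_of_measurable. Qed.

Lemma gaussian_mx_of_seq k : gaussian_seq Q -> gaussian_mx (Q k).
Proof.
move=> [ind law]; split => [s B us mB|ij B mB]; last exact: (law (k, ij.1, ij.2)).
pose emb (ij : 'I_n * 'I_d) := (k, ij.1, ij.2).
have emb_inj : injective emb by move=> [i j] [i' j'] [-> ->].
have := ind [seq emb ij | ij <- s] (fun e => B (e.1.2, e.2)).
rewrite map_inj_uniq// => /(_ us (fun _ => mB _)).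
rewrite big_map /= => E; rewrite (eq_bigr _ (fun i _ => erefl)).
rewrite [RHS](_ : _ = (\prod_(j <- s)
  P (Q k j.1 j.2 @^-1` B (j.1, j.2)))%E); last first.
  by apply: eq_bigr => -[].
rewrite -E; congr (P _); apply/seteqP; split => w /= wB.
  by move=> _ /mapP[[i j] ijs ->]; exact: (wB (i, j)).
by move=> [i j] ijs; apply: (wB (emb (i, j))); exact: map_f.
Qed.

End gaussian_blocks.

Section union_bound.
Context d0 {T : measurableType d0} {R : realType} (P : probability T R).

Lemma probability_setI_ge (A B : set T) (a b : R) :
  measurable A -> measurable B -> ((1 - a)%:E <= P A)%E -> ((1 - b)%:E <= P B)%E ->
  ((1 - (a + b))%:E <= P (A `&` B))%E.
Proof.
move=> mA mB; have mAB := measurableI _ _ mA mB.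
have AE : (P A <= P (A `&` B) + P (~` B))%E.
  rewrite (measureDI P mA mB) addeC leeD2l// le_measure ?inE//.
  - exact: measurableD.
  - exact: measurableC.
move: AE; rewrite probability_setC//.
rewrite -(fineK (fin_num_measure P _ mA)) -(fineK (fin_num_measure P _ mB)).
rewrite -(fineK (fin_num_measure P _ mAB)) !lee_fin => *; lra.
Qed.

End union_bound.

Section measurable_sets.
Context d0 {T : measurableType d0} {R : realType}.

Lemma measurable_set_le (u v : T -> R) :
  measurable_fun setT u -> measurable_fun setT v ->
  measurable [set w | u w <= v w].
Proof.
move=> mu mv; rewrite -[X in measurable X]setTI.
by have := measurable_fun_ler mu mv measurableT (Y := [set true]); apply.
Qed.

(** The two concentration events have to be measurable before a union bound
    applies to them. *)
Lemma measurable_JL_event n d eps (Q : T -> 'M[R]_(n, d)) (g : T -> 'cV[R]_n) :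
  measurable_mx Q -> measurable_mx g ->
  measurable [set w | (1 - eps) * enorm (g w) ^+ 2 <=
    enorm ((Num.sqrt d%:R)^-1 *: ((Q w)^T *m g w)) ^+ 2 <=
    (1 + eps) * enorm (g w) ^+ 2].
Proof.
move=> mQ mg.
have mg2 : measurable_fun setT (fun w => enorm (g w) ^+ 2).
  by apply: measurable_funX; exact: measurable_enorm.
have mY : measurable_fun setT
    (fun w => enorm ((Num.sqrt d%:R)^-1 *: ((Q w)^T *m g w)) ^+ 2).
  apply: measurable_funX; apply: measurable_enorm; apply: measurable_mxZ => //.
  by apply: measurable_mxM => //; exact: measurable_mxT.
have mA a : measurable_fun setT (fun w => a * enorm (g w) ^+ 2).
  by apply: measurable_funM => //; exact: measurable_cst.
rewrite -[X in measurable X]setTI.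
by have := measurable_and (measurable_fun_ler (mA (1 - eps)) mY)
  (measurable_fun_ler mY (mA (1 + eps))) measurableT (Y := [set true]); apply.
Qed.

Lemma measurable_opnorm_event n d C (Q : T -> 'M[R]_(n, d)) :
  measurable_mx Q ->
  measurable [set w | d%:R^-1 * opnorm (Q w *m (Q w)^T) <= C * (n%:R / d%:R)].
Proof.
move=> mQ; have mQQ : measurable_mx (fun w => Q w *m (Q w)^T).
  by apply: measurable_mxM => //; exact: measurable_mxT.
case: d Q mQ mQQ => [|d] Q mQ mQQ.
  rewrite invr0; under eq_set do rewrite mul0r.
  by apply: measurable_set_le; exact: measurable_cst.
rewrite (_ : mkset _ =
    [set w | opnorm (Q w *m (Q w)^T) <= C * (n%:R / d.+1%:R) * d.+1%:R]).
  exact: measurable_opnorm_le.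
by apply/seteqP; split => w /=; rewrite ler_pdivrMl ?ltr0n// (mulrC d.+1%:R).
Qed.

Lemma measurable_well_conditioned n d C eps
    (Q : T -> 'M[R]_(n, d)) (g : T -> 'cV[R]_n) :
  measurable_mx Q -> measurable_mx g ->
  measurable [set w | well_conditioned C eps (Q w) (g w)].
Proof.
move=> mQ mg.
exact: measurableI (measurable_JL_event eps mQ mg) (measurable_opnorm_event C mQ).
Qed.

End measurable_sets.
(** * Invariants of a run *)

Section run_invariants.
Context d0 {T : measurableType d0} {R : realType} (P : probability T R).
Context (n d m : nat) (f : 'cV[R]_n -> R) (beta c M1 M2 : R).
Context (x0 : 'cV[R]_n) (H0 : 'M[R]_m) (Pinit : 'M[R]_(n, m)).
Context (Q : nat -> 'I_n -> 'I_d -> {RV P >-> R}).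
Context (x : nat -> T -> 'cV[R]_n) (Pk : nat -> T -> 'M[R]_(n, m)).
Context (H : nat -> T -> 'M[R]_m) (alpha : nat -> T -> R).
Hypothesis run : qn_run f beta c M1 M2 x0 H0 Pinit Q x Pk H alpha.
Hypothesis M12 : M1 <= M2.
Hypothesis H0_bounds : sym_between M1 M2 H0.
Hypothesis Pinit1 : forall j, enorm (col j Pinit) = 1.

Let prev_cols k w := if k is k'.+1 then Pk k' w else Pinit.

Lemma run_cols_le1 k w : cols_le1 (Pk k w).
Proof.
elim: k => [|k IH]; rewrite (run_P run);
  apply: cols_le1_push_cols => //; try exact: enorm_normalized.
by move=> j; rewrite Pinit1.
Qed.

Lemma run_H_between k w : sym_between M1 M2 (H k w).
Proof.
elim: k => [|k IH]; first by rewrite (run_H0 run).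
have := run_H run (k := k) (w := w); have [B _ degenerate] := run_H_degenerate run k.
case: eqVneq => [/degenerate [? ->] //|_ /(_ isT)].
exact: clip_spectrum_between.
Qed.

Hypothesis df : forall x, differentiable f x.
Hypothesis cgrad : continuous (grad f).

Let cf : continuous f.
Proof. by move=> y; exact: differentiable_continuous. Qed.

(** By induction on k, every step of the algorithm is a measurable function of
    the current state and the new sketch. The state has to contain the columns
    of the previous iteration, since each P_k recycles them. *)
Lemma run_measurable k :
  [/\ @measurable_mx _ (g_sigma_algebraType (past Q k)) R _ _ (x k),
      @measurable_mx _ (g_sigma_algebraType (past Q k)) R _ _ (H k)
    & @measurable_mx _ (g_sigma_algebraType (past Q k)) R _ _ (prev_cols k)].
Proof.
elim: k => [|k [/measurable_mx_past_step mx /measurable_mx_past_step mH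
                /measurable_mx_past_step mprev]].
  split; first 1 last.
  - have -> : H 0 = fun=> H0 by apply/funext => w; rewrite (run_H0 run).
    exact: measurable_mx_cst.
  - exact: measurable_mx_cst.
  - have -> : x 0 = fun=> x0 by apply/funext => w; rewrite (run_x0 run).
    exact: measurable_mx_cst.
set T' := g_sigma_algebraType (past Q k.+1).
have mQ : @measurable_mx _ T' R _ _ (rmx (Q k)).
  by apply: measurable_mx_rmx; rewrite mem_iota /= add0n.
have mgrad (v : T' -> 'cV[R]_n) :
    measurable_mx v -> measurable_mx (fun w => grad f (v w)).
  exact: measurable_mx_continuous_comp.
have mP : @measurable_mx _ T' R _ _ (Pk k).
  rewrite (_ : Pk k = fun w => push_cols (prev_cols k w) (normalized (x k w))
      (normalized (rmx (Q k) w *m (rmx (Q k) w)^T *m grad f (x k w)))); last first.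
    by apply/funext => w; rewrite (run_P run).
  apply: measurable_push_cols => //; apply: measurable_normalized => //.
  apply: measurable_mxM; last exact: mgrad.
  by apply: measurable_mxM => //; exact: measurable_mxT.
have mgradg (u : T' -> 'cV[R]_m) : measurable_mx u ->
    @measurable_mx _ T' R _ _ (fun w => grad (restricted f (x k w) (Pk k w)) (u w)).
  move=> mu; rewrite (_ : (fun w => _) =
    fun w => (Pk k w)^T *m grad f (x k w + Pk k w *m u w)); last first.
    by apply/funext => w; rewrite grad_restricted.
  apply: measurable_mxM; first exact: measurable_mxT.
  by apply: mgrad; apply: measurable_mxD => //; exact: measurable_mxM.
have mgrad0 : @measurable_mx _ T' R _ _
    (fun w => grad (restricted f (x k w) (Pk k w)) 0).
  by apply: mgradg; exact: measurable_mx_cst.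
pose dir w := - (H k w *m grad (restricted f (x k w) (Pk k w)) 0).
have mdir : @measurable_mx _ T' R _ _ dir.
  by apply: measurable_mxN; exact: measurable_mxM.
have mPdir : @measurable_mx _ T' R _ _ (fun w => Pk k w *m dir w).
  exact: measurable_mxM.
have mf (v : T' -> 'cV[R]_n) :
    measurable_mx v -> measurable_fun setT (fun w => f (v w)).
  exact: measurable_continuous_comp.
have malpha : measurable_fun setT (alpha k : T' -> R).
  apply: (measurable_first_power (T := T') (beta := beta)
    (A := fun w : T' => armijo f c (x k w) (Pk k w) (dir w))); last first.
    exact: (run_alpha run).
  move=> i; apply: measurable_set_le.
    apply: mf; apply: measurable_mxD => //; apply: measurable_mxZ => //.
  apply: measurable_funD.
    by apply: mf; apply: measurable_mxD => //; exact: measurable_mxM.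
  by apply: measurable_funM => //; exact: measurable_dotv.
pose s w := alpha k w *: dir w.
pose y w := grad (restricted f (x k w) (Pk k w)) (s w) -
            grad (restricted f (x k w) (Pk k w)) 0.
have ms : @measurable_mx _ T' R _ _ s by exact: measurable_mxZ.
have my : @measurable_mx _ T' R _ _ y.
  by apply: measurable_mxB => //; exact: mgradg.
split => //.
  rewrite (_ : x k.+1 = fun w => x k w + alpha k w *: (Pk k w *m dir w)); last first.
    by apply/funext => w; rewrite (run_x run).
  by apply: measurable_mxD => //; exact: measurable_mxZ.
have [B /history_measurable_past mB degenerate] := run_H_degenerate run k.
move=> i j.
rewrite (_ : (fun w => _) =
  fun w => if dotv (s w) (y w) == 0 then B w i j else H k.+1 w i j); last first.
  by apply/funext => w; case: eqP => // /degenerate [_ ->].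
have msy : measurable_fun setT (fun w : T' => dotv (s w) (y w) == 0).
  by apply: measurable_fun_eqr => //; exact: measurable_dotv.
apply: measurable_fun_if => //; first by apply: measurable_funS (mB i j).
apply: (measurable_clip_spectrum (a := M1) (b := M2)
  (X := fun w : T' => bfgs (H k w) (s w) (y w))).
  exact: measurable_bfgs.
by move=> w [_ /=] /negbT; exact: (run_H run).
Qed.

Hypotheses (beta01 : 0 < beta < 1) (c01 : 0 < c < 1) (M1_gt0 : 0 < M1).
Hypotheses (m_gt0 : (0 < m)%N) (m_even : ~~ odd m).
Variable L : R.
Hypothesis L_gt0 : 0 < L.
Hypothesis f_smooth : forall u v, enorm (grad f u - grad f v) <= L * enorm (u - v).

Let abar := alpha_bar m beta c M2 L.

Lemma run_decrease k w :
  f (x k.+1 w) + c * abar * M1 * enorm ((Pk k w)^T *m grad f (x k w)) ^+ 2 <=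
  f (x k w).
Proof.
rewrite (run_x run).
exact: (armijo_decrease df f_smooth beta01 c01 M1_gt0 M12 L_gt0 m_gt0
  (@run_cols_le1 k w) (run_H_between k w) (run_alpha run k w)).
Qed.

Lemma run_nonincreasing k w : f (x k.+1 w) <= f (x k w).
Proof.
apply: le_trans (run_decrease k w); rewrite lerDl.
exact: mulr_ge0 (decrease_factor_ge0 m M12 beta01 c01 M1_gt0 L_gt0) (sqr_ge0 _).
Qed.

Variables (fstar sigma C eps : R).
Hypothesis d_gt0 : (0 < d)%N.
Hypothesis n_gt0 : (0 < n)%N.
Hypothesis C_gt0 : 0 < C.
Hypothesis eps01 : 0 < eps < 1.
Hypothesis f_PL : forall x, 2 * sigma * (f x - fstar) <= enorm (grad f x) ^+ 2.

(** The last column of P_k is the normalized sketched gradient, so on the good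
    event the projected gradient keeps a fixed proportion of the gradient, and
    the Polyak-Lojasiewicz inequality turns this into a proportion of the
    optimality gap. *)
Lemma run_contraction k w :
  well_conditioned C eps (rmx (Q k) w) (grad f (x k w)) ->
  f (x k.+1 w) - fstar + 2 * sigma * c * abar * M1 *
    ((1 - eps) * d%:R / (C * n%:R)) ^+ 2 * (f (x k w) - fstar) <=
  f (x k w) - fstar.
Proof.
set rho2 := (_ / _) ^+ 2 => good.
have [j jE] := last_col_push_cols (if k is k'.+1 then Pk k' w else Pinit)
  (normalized (x k w))
  (normalized (rmx (Q k) w *m (rmx (Q k) w)^T *m grad f (x k w))) m_gt0 m_even.
have := dotv_col_le (Pk k w) (grad f (x k w)) j.
rewrite {1}(run_P run) jE => proj.
have {proj} := le_trans
  (well_conditioned_projection d_gt0 n_gt0 C_gt0 eps01 good) proj.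
rewrite -/rho2 => proj.
have PL := ler_wpM2l (sqr_ge0 _ : 0 <= rho2) (f_PL (x k w)).
have factor_ge0 : 0 <= c * abar * M1.
  exact: (decrease_factor_ge0 m M12 beta01 c01 M1_gt0 L_gt0).
have := ler_wpM2l factor_ge0 (le_trans PL proj); have := run_decrease k w.
lra.
Qed.

End run_invariants.

(** * Recursion on the expected gap *)

(** When r < 0, the recursion forces every term of the nonnegative sequence e
    to vanish; otherwise it is iterated. *)
Lemma geometric_decay {R : realType} (r : R) (e : nat -> R) k :
  (forall k, 0 <= e k) -> (forall k, e k.+1 <= r * e k) -> e k <= r ^+ k * e 0.
Proof.
move=> e0 er; have [r0|r0] := leP 0 r.
  elim: k => [|k IH]; first by rewrite expr0 mul1r.
  by rewrite (le_trans (er k))// exprS -mulrA ler_wpM2l.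
have e_eq0 j : e j = 0.
  apply/eqP; rewrite eq_le e0 andbT.
  by have := le_trans (e0 j.+1) (er j); rewrite nmulr_rge0.
by rewrite !e_eq0 mulr0.
Qed.
Section success_event.
Context d0 {T : measurableType d0} {R : realType} (P : probability T R).
Context (n d : nat) (C0 C : R).

Lemma well_conditioned_probability (Q : 'I_n -> 'I_d -> {RV P >-> R}) eps v :
  JL_constant P n d C0 -> opnorm_constant P n d C -> gaussian_mx Q ->
  0 < eps < 1 ->
  ((success_prob C0 d eps)%:E <= P [set w | well_conditioned C eps (rmx Q w) v])%E.
Proof.
move=> JL op gQ eps01.
have mQ : measurable_mx (rmx Q).
  by move=> i j; under eq_fun do rewrite mxE; exact: measurable_funP.
have mv : measurable_mx (fun _ : T => v) by exact: measurable_mx_cst.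
apply: (@probability_setI_ge _ _ _ P
  [set w | (1 - eps) * enorm v ^+ 2 <=
    enorm ((Num.sqrt d%:R)^-1 *: ((rmx Q w)^T *m v)) ^+ 2 <= (1 + eps) * enorm v ^+ 2]
  [set w | d%:R^-1 * opnorm (rmx Q w *m (rmx Q w)^T) <= C * (n%:R / d%:R)]).
- exact: (measurable_JL_event eps mQ mv).
- exact: measurable_opnorm_event.
- exact: JL.
- exact: op.
Qed.

End success_event.

Lemma bounded_expectation_fin_num d0 (T : measurableType d0) (R : realType)
    (P : probability T R) (u : T -> R) (B : R) :
  measurable_fun setT u -> (forall w, 0 <= u w <= B) ->
  (\int[P]_w (u w)%:E)%E \is a fin_num.
Proof.
move=> mu uB; rewrite ge0_fin_numE; last first.
  by apply: integral_ge0 => w _; rewrite lee_fin; have /andP[] := uB w.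
apply: (@le_lt_trans _ _ (\int[P]_w (cst B%:E w))%E).
  apply: ge0_le_integral => //.
  - by move=> w _; rewrite lee_fin; have /andP[] := uB w.
  - exact/measurable_EFinP.
  - by move=> w _; rewrite lee_fin; have /andP[] := uB w.
by rewrite integral_cst// [X in (_ * X)%E](probability_setT P) mule1 ltry.
Qed.

Section expected_decrease.
Context d0 {T : measurableType d0} {R : realType} (P : probability T R).
Context (n d : nat) (Q : nat -> 'I_n -> 'I_d -> {RV P >-> R}).
Hypothesis Q_gaussian : gaussian_seq Q.
Variables (C0 C eps : R).
Hypotheses (JL : JL_constant P n d C0) (op : opnorm_constant P n d C).
Hypothesis eps01 : 0 < eps < 1.

(** Both h and v are functions of the past sketches, hence independent of the
    sketch Q k; freezing them reduces the claim to the probability that Q k is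
    well conditioned for a deterministic direction. *)
Lemma expected_success k (h : T -> R) (v : T -> 'cV[R]_n) :
  measurable_fun setT (h : g_sigma_algebraType (past Q k) -> R) ->
  @measurable_mx _ (g_sigma_algebraType (past Q k)) R _ _ v ->
  (forall w, 0 <= h w) ->
  let good := [set w | well_conditioned C eps (rmx (Q k) w) (v w)] in
  measurable good /\
  ((success_prob C0 d eps)%:E * \int[P]_w (h w)%:E <=
   \int[P]_w (h w * \1_good w)%:E)%E.
Proof.
move=> mh mv h0 good.
set p := success_prob _ _ _.
pose T1 := g_sigma_algebraType (past Q k).
pose T2 := g_sigma_algebraType (present Q k).
have uniq_blocks : uniq (entries n d (iota 0 k) ++ entries n d [:: k]).
  apply: uniq_entries_cat; rewrite cat_uniq iota_uniq /= mem_iota /= add0n ltnn.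
  by [].
have [indep _] := Q_gaussian.
pose D : set (T1 * T2) := [set z | well_conditioned C eps (rmx (Q k) z.2) (v z.1)].
have mD : measurable D.
  apply: measurable_well_conditioned => i j.
    apply: (measurableT_comp (f := fun w : T2 => rmx (Q k) w i j)).
      by apply: (@measurable_mx_rmx _ _ _ _ _ _ _ [:: k]); rewrite mem_head.
    exact: measurable_snd.
  apply: (measurableT_comp (f := fun w : T1 => v w i j)); first exact: mv.
  exact: measurable_fst.
have goodE w : \1_D (w, w) = \1_good w :> R by rewrite !indicE.
have mgood : measurable good.
  have := measurable_diagonal (X := entry_of Q) (s1 := entries n d (iota 0 k))
    (s2 := entries n d [:: k]) measurableT mD.
  by rewrite setTI.
split => //.
rewrite [leRHS](eq_integral (fun w : T => (h w * \1_D (w, w))%:E)); last first.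
  by move=> w _; rewrite goodE.
have int_ge0 : (0 <= \int[P]_w (h w)%:E)%E.
  by apply: integral_ge0 => w _; rewrite lee_fin.
(* The probability bound is void when p < 0: the left-hand side is then
   nonpositive. *)
have [p0|p0] := leP 0 p; last first.
  apply: (@le_trans _ _ 0%E).
    by rewrite mule_le0_ge0// lee_fin ltW.
  by apply: integral_ge0 => w _; rewrite lee_fin mulr_ge0.
apply: (freezing indep uniq_blocks mD mh h0 p0) => w.
rewrite (_ : xsection D w = [set w' | well_conditioned C eps (rmx (Q k) w') (v w)]).
  by apply: well_conditioned_probability => //; exact: gaussian_mx_of_seq.
by apply/seteqP; split => w'; rewrite /xsection /= inE.
Qed.

(** h is the gap before the step and h' the gap after it: h' <= h always, and a
    fraction kappa of h is gained on the good event. *)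
Lemma expected_contraction k (h h' : T -> R) (v : T -> 'cV[R]_n) (kappa B : R) :
  measurable_fun setT (h : g_sigma_algebraType (past Q k) -> R) ->
  measurable_fun setT (h' : T -> R) ->
  @measurable_mx _ (g_sigma_algebraType (past Q k)) R _ _ v ->
  (forall w, 0 <= h w <= B) -> (forall w, 0 <= h' w <= h w) -> 0 <= kappa ->
  (forall w, well_conditioned C eps (rmx (Q k) w) (v w) ->
     h' w + kappa * h w <= h w) ->
  fine (\int[P]_w (h' w)%:E)%E <=
  (1 - kappa * success_prob C0 d eps) * fine (\int[P]_w (h w)%:E)%E.
Proof.
move=> mh mh' mv hB h'h k0 step.
have h0 w : 0 <= h w by have /andP[] := hB w.
have h'0 w : 0 <= h' w by have /andP[] := h'h w.
have [/=] := expected_success mh mv h0.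
set good := mkset _; set p := success_prob _ _ _ => mgood low.
have mhT : measurable_fun setT (h : T -> R).
  by move=> _ A mA; apply: measurable_past (mh measurableT A mA).
have mhg : measurable_fun setT (fun w => h w * \1_good w).
  by apply: measurable_funM => //; exact: measurable_indic.
have hg0 w : 0 <= h w * \1_good w by rewrite mulr_ge0.
have fin := bounded_expectation_fin_num P (B := B).
have fh : (\int[P]_w (h w)%:E)%E \is a fin_num by exact: fin.
have fh' : (\int[P]_w (h' w)%:E)%E \is a fin_num.
  apply: fin => // w; have /andP[-> /le_trans-> //] := h'h w.
  by have /andP[] := hB w.
have fhg : (\int[P]_w (h w * \1_good w)%:E)%E \is a fin_num.
  apply: fin => // w; rewrite hg0 /= indicE.
  have /andP[hw hwB] := hB w.
  by case: (w \in good); rewrite ?mulr1 ?mulr0// (le_trans hw).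
have : (\int[P]_w (h' w)%:E + kappa%:E * \int[P]_w (h w * \1_good w)%:E <=
        \int[P]_w (h w)%:E)%E.
  rewrite -ge0_integralZl//; last 2 first.
  - exact/measurable_EFinP.
  - by move=> w _; rewrite lee_fin.
  rewrite -ge0_integralD//; last 4 first.
  - by move=> w _; rewrite lee_fin.
  - exact/measurable_EFinP.
  - by move=> w _; rewrite mule_ge0// lee_fin.
  - by apply: measurable_funeM; exact/measurable_EFinP.
  apply: ge0_le_integral => //.
  - by move=> w _; rewrite adde_ge0// ?mule_ge0// lee_fin.
  - apply: emeasurable_funD; first exact/measurable_EFinP.
    by apply: measurable_funeM; exact/measurable_EFinP.
  - exact/measurable_EFinP.
  move=> w _; rewrite -EFinM -EFinD lee_fin indicE.
  case: (boolP (w \in good)) => [/set_mem gw|_].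
    by rewrite mulr1; exact: step.
  by rewrite !mulr0 addr0; have /andP[] := h'h w.
move: low; rewrite -(fineK fh) -(fineK fh') -(fineK fhg).
rewrite -!EFinM -EFinD !lee_fin => low up.
have := ler_wpM2l k0 low; lra.
Qed.

End expected_decrease.

Theorem theorem7
  (R : realType)
  (d0 : measure_display) (T : measurableType d0) (P : probability T R)
  (n d m : nat)
  (d_gt0 : (0 < d)%N) (m_gt0 : (0 < m)%N) (m_even : ~~ odd m)
  (d_lt_n : (d < n)%N) (m_lt_n : (m < n)%N)
  (f : 'cV[R]_n -> R) (f_C2 : class_C2 f)
  (fstar : R)
  (f_bounded_below : has_lbound (range f)) (fstarE : fstar = inf (range f))
  (beta c M1 M2 : R)
  (beta01 : 0 < beta < 1) (c01 : 0 < c < 1)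
  (M1_gt0 : 0 < M1) (M1_le_M2 : M1 <= M2)
  (C0 C : R) (C0_gt0 : 0 < C0) (C_gt0 : 0 < C)
  (hC0 : JL_constant P n d C0) (hC : opnorm_constant P n d C)
  (L : R) (L_gt0 : 0 < L)
  (f_smooth : forall u v : 'cV[R]_n,
     enorm (grad f u - grad f v) <= L * enorm (u - v))
  (sigma : R) (sigma_gt0 : 0 < sigma)
  (f_PL : forall x : 'cV[R]_n,
     2 * sigma * (f x - fstar) <= enorm (grad f x) ^+ 2)
  (x0 : 'cV[R]_n)
  (H0 : 'M[R]_m) (H0_bounds : sym_between M1 M2 H0)
  (Pinit : 'M[R]_(n, m)) (Pinit_normalized : forall j, enorm (col j Pinit) = 1)
  (Q : nat -> 'I_n -> 'I_d -> {RV P >-> R}) (Q_gaussian : gaussian_seq Q)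
  (x : nat -> T -> 'cV[R]_n) (Pk : nat -> T -> 'M[R]_(n, m))
  (H : nat -> T -> 'M[R]_m) (alpha : nat -> T -> R)
  (run : qn_run f beta c M1 M2 x0 H0 Pinit Q x Pk H alpha) :
  forall (eps : R) (k : nat), 0 < eps < 1 ->
  ('E_P[fun w => (f (x k w) - fstar)%R] <=
     ((1 - 2 * sigma * c * alpha_bar m beta c M2 L * M1
             * success_prob C0 d eps
             * ((1 - eps) * d%:R / (C * n%:R)) ^+ 2) ^+ k
        * (f x0 - fstar))%:E)%E.
Proof.
move=> eps k eps01.
have [df dgrad _] := f_C2.
have cgrad : continuous (grad f) by move=> y; exact: differentiable_continuous.
have n_gt0 : (0 < n)%N by exact: leq_ltn_trans d_lt_n.
have fstar_le y : fstar <= f y by rewrite fstarE; apply: ge_inf => //; exists y.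
set kappa := 2 * sigma * c * alpha_bar m beta c M2 L * M1 *
  ((1 - eps) * d%:R / (C * n%:R)) ^+ 2.
have kappa_ge0 : 0 <= kappa.
  rewrite /kappa mulr_ge0 ?sqr_ge0// -(mulrA _ _ M1) -(mulrA _ c) (mulrA c).
  rewrite mulr_ge0//; first by rewrite mulr_ge0 ?(ltW sigma_gt0).
  exact: (decrease_factor_ge0 m M1_le_M2 beta01 c01 M1_gt0 L_gt0).
pose h j w := f (x j w) - fstar.
have h_ge0 j w : 0 <= h j w by rewrite subr_ge0.
have h_noninc j w : h j.+1 w <= h j w.
  rewrite lerD2r.
  exact: (run_nonincreasing run M1_le_M2 H0_bounds Pinit_normalized df beta01
    c01 M1_gt0 m_gt0 L_gt0 f_smooth).
have h_le j w : 0 <= h j w <= f x0 - fstar.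
  rewrite h_ge0 /=; elim: j => [|j IH]; last exact: le_trans (h_noninc j w) IH.
  by rewrite /h (run_x0 run).
have mx j : @measurable_mx _ (g_sigma_algebraType (past Q j)) R _ _ (x j).
  by have [] := run_measurable run df cgrad j.
have mh j : measurable_fun setT (h j : g_sigma_algebraType (past Q j) -> R).
  apply: measurable_funB; last exact: measurable_cst.
  apply: (measurable_continuous_comp _ (mx j)).
  by move=> y; exact: differentiable_continuous.
have mhT j : measurable_fun setT (h j : T -> R).
  by move=> _ A mA; apply: measurable_past (mh j measurableT A mA).
pose e j := fine (\int[P]_w (h j w)%:E)%E.
have e0 : e 0 = f x0 - fstar.
  rewrite /e (_ : (fun w => _) = cst (f x0 - fstar)%:E); last first.
    by apply/funext => w; rewrite /h (run_x0 run).
  by rewrite integral_cst// [X in (_ * X)%E](probability_setT P) mule1.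
have e_ge0 j : 0 <= e j.
  by apply: fine_ge0; apply: integral_ge0 => w _; rewrite lee_fin.
have step j : e j.+1 <= (1 - kappa * success_prob C0 d eps) * e j.
  apply: (expected_contraction Q_gaussian hC0 hC eps01 (v := fun w => grad f (x j w))
    (mh j) (mhT j.+1) _ (h_le j)) => //.
  - exact: measurable_mx_continuous_comp.
  - by move=> w; rewrite h_ge0 h_noninc.
  - move=> w good; rewrite /h /kappa.
    exact: (run_contraction run M1_le_M2 H0_bounds Pinit_normalized df beta01 c01
      M1_gt0 m_gt0 m_even L_gt0 f_smooth d_gt0 n_gt0 C_gt0 eps01 f_PL good).
have := geometric_decay k e_ge0 step; rewrite e0.
rewrite [X in (1 - X) ^+ k](_ : _ = 2 * sigma * c * alpha_bar m beta c M2 L * M1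
  * success_prob C0 d eps * ((1 - eps) * d%:R / (C * n%:R)) ^+ 2); last first.
  by rewrite /kappa mulrAC.
rewrite -lee_fin; apply: le_trans; rewrite unlock fineK//.
exact: bounded_expectation_fin_num (mhT k) (h_le k).
Qed.
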